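(* Let $n\ge 1$ be an integer, let $E$ be the elliptic curve $y^2=x^3-x$ over $\mathbb{F}_9$, let $\mathcal{X}$ be a curve defined over $\mathbb{F}_{3^{2n}}$, and put $K=\mathbb{F}_{3^{2n}}(\mathcal{X})$. Let $f,g\in K\setminus\mathbb{F}_{3^{2n}}$ be such that $f$ is not a square in $K$ and $g\neq h^3-h$ for every $h\in K$. Then $E$, considered over $K$, admits the following twists: \begin{itemize} \item quadratic twist: $E_2:\ \eta^2=\xi^3-f^2\xi$; \item cubic twists: $E_{3,\tau}:\ \eta^2=\xi^3-\xi-g$ and $E_{3,\tau^2}:\ \eta^2=\xi^3-\xi+g$; \item quartic twists: $E_{4,\tau}:\ \eta^2=\xi^3-f\xi$ and $E_{4,\tau^3}:\ \eta^2=\xi^3-f^3\xi$; \item sextic twists: $E_{6,\tau}:\ \eta^2=\xi^3-f^2\xi+f^3g$ and $E_{6,\tau^5}:\ \eta^2=\xi^3-f^2\xi-f^3g$. \end{itemize}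
   Context: $\mathbb{F}_{3^{2n}}$ is the finite field with $3^{2n}$ elements. A curve over $\mathbb{F}_{3^{2n}}$ is smooth, projective and geometrically irreducible, and $\mathbb{F}_{3^{2n}}(\mathcal{X})$ denotes its function field. For $m\in\{2,3,4,6\}$, an elliptic curve $E'$ over $K$ is called a (respectively quadratic, cubic, quartic, sextic) twist of $E$ over $K$ if $E'$ becomes isomorphic to $E$ over some extension of $K$ of degree $m$, and $E'$ is not isomorphic to $E$ over any extension of $K$ of degree smaller than $m$. *)

(* Defs.v *)
From HB Require Import structures.
From mathcomp Require Import all_boot all_order all_algebra all_field.
From mathcomp Require Import mpoly.

Set Implicit Arguments.
Unset Strict Implicit.
Unset Printing Implicit Defensive.

Import GRing.Theory.
Local Open Scope ring_scope.

(* A closed subset of P^N over k is given by a set of forms in N + 1 variables;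
   its points are taken with homogeneous coordinates in arbitrary extension
   fields i : k -> M.  Using all extension fields instead of one algebraic
   closure of k gives the same notions (vanishing, smoothness, morphisms, ...)
   and avoids choosing a closure. *)
Definition projset (k : fieldType) (N : nat) := {mpoly k[N.+1]} -> Prop.

Section Projective.
Variable k : fieldType.

Definition ev (M : fieldType) (i : {rmorphism k -> M}) (N : nat)
  (P : 'I_N.+1 -> M) (G : {mpoly k[N.+1]}) : M := (map_mpoly i G).@[P].

Definition on (N : nat) (V : projset k N) (M : fieldType)
    (i : {rmorphism k -> M}) (P : 'I_N.+1 -> M) : Prop :=
  (exists a, P a != 0) /\ forall G, V G -> ev i P G = 0.

Definition samept (M : fieldType) (N : nat) (P Q : 'I_N.+1 -> M) : Prop :=
  (exists a, P a != 0) /\ exists2 c : M, c != 0 & forall a, Q a = c * P a.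

Definition vanishes (N : nat) (V : projset k N) (G : {mpoly k[N.+1]}) : Prop :=
  forall (M : fieldType) (i : {rmorphism k -> M}) (P : 'I_N.+1 -> M),
    on V i P -> ev i P G = 0.

Definition homogeneous (N : nat) (V : projset k N) : Prop :=
  forall G, V G -> exists d, G \is d.-homog.

Definition irreducible_projset (N : nat) (V : projset k N) : Prop :=
  (exists (M : fieldType) (i : {rmorphism k -> M}) (P : 'I_N.+1 -> M), on V i P)
  /\ forall (d e : nat) (G H : {mpoly k[N.+1]}),
       G \is d.-homog -> H \is e.-homog ->
       vanishes V (G * H) -> vanishes V G \/ vanishes V H.

(* Jacobian criterion: at every geometric point, forms in the ideal of V have a
   Jacobian matrix of rank N - d.  It expresses smoothness when d = dim V. *)
Definition smooth (N : nat) (V : projset k N) (d : nat) : Prop :=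
  forall (M : fieldType) (i : {rmorphism k -> M}) (P : 'I_N.+1 -> M), on V i P ->
  exists (r : nat) (G : 'I_r -> {mpoly k[N.+1]}),
    (forall a, vanishes V (G a)) /\
    (\rank (\matrix_(a < r, b < N.+1) ev i P (G a)^`M(b)) + d)%N = N.

(* K is the function field of V, i.e. the field of quotients G/H of forms of the
   same degree, H not vanishing on V, modulo equality on V.  The coordinates x
   are those of the generic point: G/H corresponds to G(x)/H(x). *)
Definition function_field (N : nat) (V : projset k N) (K : fieldType)
    (iota : {rmorphism k -> K}) : Prop :=
  exists x : 'I_N.+1 -> K,
    (forall (d : nat) (G : {mpoly k[N.+1]}), G \is d.-homog ->
       (ev iota x G = 0 <-> vanishes V G)) /\
    (forall z : K, exists (d : nat) (G H : {mpoly k[N.+1]}),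
       [/\ G \is d.-homog, H \is d.-homog, ev iota x H != 0
         & z = ev iota x G / ev iota x H]).

Definition trdeg1 (K : fieldType) (iota : {rmorphism k -> K}) : Prop :=
  exists t : K, ~ algebraicOver iota t /\
    forall z : K, exists2 Q : {poly {poly k}},
      Q != 0 & (map_poly (map_poly iota) Q).[z%:P].[t] = 0.

Definition dim1 (N : nat) (V : projset k N) : Prop :=
  forall (K : fieldType) (iota : {rmorphism k -> K}),
    function_field V iota -> trdeg1 iota.

(* A morphism V -> V' over k, V in P^N and V' in P^N', is given by a family Phi
   of tuples G = (G_0, ..., G_N') of forms of equal degree over k:
   P is mapped to [G_0(P) : ... : G_N'(P)] for any G in Phi that does not
   vanish identically at P; some G must be usable at every point, and the
   result must lie on V' and not depend on G. *)
Definition maps_to (N N' : nat) (Phi : ('I_N'.+1 -> {mpoly k[N.+1]}) -> Prop)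
    (M : fieldType) (i : {rmorphism k -> M})
    (P : 'I_N.+1 -> M) (Q : 'I_N'.+1 -> M) : Prop :=
  exists2 G, Phi G & samept (fun a => ev i P (G a)) Q.

Definition is_morphism (N N' : nat) (V : projset k N) (V' : projset k N')
    (Phi : ('I_N'.+1 -> {mpoly k[N.+1]}) -> Prop) : Prop :=
  [/\ forall G, Phi G -> exists d, forall a, G a \is d.-homog,
      forall (M : fieldType) (i : {rmorphism k -> M}) P, on V i P ->
        exists2 Q, on V' i Q & maps_to Phi i P Q
    & forall (M : fieldType) (i : {rmorphism k -> M}) P Q Q', on V i P ->
        maps_to Phi i P Q -> maps_to Phi i P Q' -> samept Q Q'].

Definition pointed_isomorphic (N N' : nat) (V : projset k N) (O : 'I_N.+1 -> k)
    (V' : projset k N') (O' : 'I_N'.+1 -> k) : Prop :=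
  exists Phi Psi,
    [/\ is_morphism V V' Phi, is_morphism V' V Psi,
        forall (M : fieldType) (i : {rmorphism k -> M}) P Q, on V i P ->
          maps_to Phi i P Q -> maps_to Psi i Q P,
        forall (M : fieldType) (i : {rmorphism k -> M}) P Q, on V' i Q ->
          maps_to Psi i Q P -> maps_to Phi i P Q
      & maps_to Phi (idfun : {rmorphism k -> k}) O O'].

End Projective.

Definition base_change (k M : fieldType) (i : {rmorphism k -> M}) (N : nat)
    (V : projset k N) : projset M N :=
  fun G' => exists2 G, V G & G' = map_mpoly i G.

Definition geom_irreducible (k : fieldType) (N : nat) (V : projset k N) : Prop :=
  forall (M : fieldType) (i : {rmorphism k -> M}),
    irreducible_projset (base_change i V).

Definition is_curve (k : fieldType) (N : nat) (V : projset k N) : Prop :=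
  [/\ homogeneous V, geom_irreducible V, dim1 V & smooth V 1].

(* y^2 + a1 xy + a3 y = x^3 + a2 x^2 + a4 x + a6 *)
Record weierstrass (k : fieldType) := Weierstrass
  { wa1 : k; wa2 : k; wa3 : k; wa4 : k; wa6 : k }.

(* y^2 = x^3 + A x + B *)
Definition short_weierstrass (k : fieldType) (A B : k) : weierstrass k :=
  Weierstrass 0 0 0 A B.

Definition wmap (k M : fieldType) (i : {rmorphism k -> M}) (W : weierstrass k) :
    weierstrass M :=
  Weierstrass (i (wa1 W)) (i (wa2 W)) (i (wa3 W)) (i (wa4 W)) (i (wa6 W)).

Definition wform (k : fieldType) (W : weierstrass k) : {mpoly k[3]} :=
  let X : {mpoly k[3]} := 'X_0 in
  let Y : {mpoly k[3]} := 'X_1 in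
  let Z : {mpoly k[3]} := 'X_2 in
  Y ^+ 2 * Z + wa1 W *: (X * Y * Z) + wa3 W *: (Y * Z ^+ 2)
  - (X ^+ 3 + wa2 W *: (X ^+ 2 * Z) + wa4 W *: (X * Z ^+ 2) + wa6 W *: Z ^+ 3).

Definition wcurve (k : fieldType) (W : weierstrass k) : projset k 2 :=
  fun G => G = wform W.

(* The origin [0 : 1 : 0]. *)
Definition worigin (k : fieldType) : 'I_3 -> k := fun a => (a == 1)%:R.

(* A Weierstrass cubic always has dimension 1 and is geometrically irreducible,
   so only smoothness has to be required. *)
Definition elliptic (k : fieldType) (W : weierstrass k) : Prop :=
  smooth (wcurve W) 1.

Definition isomorphic (k : fieldType) (W W' : weierstrass k) : Prop :=
  pointed_isomorphic (wcurve W) (@worigin k) (wcurve W') (@worigin k).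

Definition isomorphic_over (K : fieldType) (L : fieldExtType K)
    (W W' : weierstrass K) : Prop :=
  isomorphic (wmap (in_alg L) W) (wmap (in_alg L) W').

(* W' is a twist of W of degree m: m = 2, 3, 4, 6 for quadratic, cubic, quartic
   and sextic twists. *)
Definition is_twist (K : fieldType) (m : nat) (W W' : weierstrass K) : Prop :=
  [/\ elliptic W, elliptic W',
      exists L : fieldExtType K, \dim {:L} = m /\ isomorphic_over L W W'
    & forall L : fieldExtType K, (\dim {:L} < m)%N -> ~ isomorphic_over L W W'].

(* Main.v *)
Require Import Defs.
From HB Require Import structures.
From Stdlib Require Import Classical.
From mathcomp Require Import all_boot all_order all_algebra all_field.
From mathcomp Require Import ring zify.
From mathcomp Require Import mpoly.

Set Implicit Arguments.
Unset Strict Implicit.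
Unset Printing Implicit Defensive.

Import GRing.Theory.
Local Open Scope ring_scope.

(** In characteristic 3, two curves y^2 = x^3 + a x + b and
    y^2 = x^3 + a' x + b' are isomorphic over a field, origin to origin, if and
    only if it contains u <> 0 and s with u^4 a = a' and
    u^6 b = s^3 + a' s + b'.  For a = -1 and b = 0 this turns each claim into a
    statement about equations in extensions of K, where -1 is a square
    because K contains a copy of F_9.  The quadratic and quartic twists need u^4 = f^2,
    respectively u^4 = f or u^4 = f^3; the cubic ones need u^4 = 1 and a root of
    s^3 - s = g or s^3 - s = -g; the sextic ones need both a square root of f and
    a root of such an Artin-Schreier equation.  Since f is not a square and g is
    not of the form h^3 - h, these conditions force the degree of an extension to
    be at least 2, 4, 3 and 6 ([even_dim_sqrt], [dim_quartic_root],
    [dvd3_dim_artin_schreier]), and in each case adjoining a root of one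
    polynomial of that degree suffices ([is_twist_of_poly]).

    The criterion itself ([change_of_isomorphic], [isomorphic_of_change]) is the
    main part.  One direction is a linear substitution.  In the other, a pointed
    isomorphism given by families of forms has to be shown to be such a
    substitution.  It sends affine points to affine points
    ([affine_point_maps_to_affine]), so its affine coordinates at a generic point
    are functions xi and eta regular at every affine point, hence elements of the
    coordinate ring ([regular_everywhere]); the same holds for its inverse, so
    x and y are polynomials in xi and eta.  The order of the pole at infinity,
    read off from the degree of the norm to k[x], then plays the role of
    Riemann-Roch: xi and eta have poles of orders 2 m and 3 m for some m, all
    nonzero polynomials in them have order a multiple of m, and x and y have
    orders 2 and 3, so m = 1 ([pole_orders_of_generators]).  Thus xi is affine
    in x, eta is affine in x and y, and comparing coefficients finishes
    ([coordinate_change]). *)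

(** * Finite field extensions *)

Lemma irreducible_factor (K : fieldType) (p : {poly K}) :
  (1 < size p)%N -> exists2 q, irreducible_poly q & q %| p.
Proof.
have [n] := ubnP (size p); elim: n p => // n IHn p /ltnSE le_pn p_gt1.
have [irr_p|red_p] := classic (irreducible_poly p); first by exists p.
have p0 : p != 0 by rewrite -size_poly_eq0 -lt0n ltnW.
have [q] : exists q : {poly K}, [/\ size q != 1, q %| p & ~~ (q %= p)].
  apply: NNPP => noq; apply: red_p; split=> // q q1 qp.
  by apply/idPn => nqp; apply: noq; exists q.
case=> q1 qp nqp.
have q0 : q != 0 by apply: contraNneq p0 => q0; rewrite q0 dvd0p in qp.
have q_gt1 : (1 < size q)%N by rewrite ltn_neqAle eq_sym q1 size_poly_gt0.
have ltqp : (size q < size p)%N.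
  by rewrite ltn_neqAle dvdp_leq // andbT dvdp_size_eqp.
have [r irr_r rq] := IHn q (leq_trans ltqp le_pn) q_gt1.
by exists r => //; apply: dvdp_trans qp.
Qed.

(** Only the upper bound on the degree is claimed: p need not be irreducible.  In
    each application a lower bound for every extension with the relevant property
    forces equality, so no irreducibility proof is needed. *)
Lemma extension_with_root (K : fieldType) (p : {poly K}) :
  (1 < size p)%N ->
  exists (L : fieldExtType K) (z : L),
    (\dim {:L} <= (size p).-1)%N /\ root (map_poly (in_alg L) p) z.
Proof.
move=> p_gt1; have p0 : p != 0 by rewrite -size_poly_eq0 -lt0n ltnW.
have [q irr_q qp] := irreducible_factor p_gt1.
have [L dimL [z qz _]] := irredp_FAdjoin irr_q.
exists L, z; split; last first.
  by case/dvdpP: qp => r ->; rewrite rmorphM rootM qz orbT.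
by rewrite dimL -!subn1 leq_sub2r // dvdp_leq.
Qed.

Lemma nonsquare_neq0 (K : fieldType) (f : K) : (forall h, f <> h ^+ 2) -> f != 0.
Proof. by move=> nsq_f; apply/eqP => f0; apply: (nsq_f 0); rewrite expr0n. Qed.

Section Degrees.
Variables (K : fieldType) (L : fieldExtType K).

Lemma adjoin_degree_dvd (z : L) : (adjoin_degree 1%AS z %| \dim {:L})%N.
Proof.
have := field_dimS (subvf <<1%AS; z>>%AS).
by rewrite dim_Fadjoin dimv1 muln1.
Qed.

(** The minimal polynomial of z over the copy of K inside L has coefficients in
    that copy, hence comes from {poly K}, where divisibility can be exploited. *)
Lemma minPoly_descent (z : L) (p : {poly K}) :
  root (map_poly (in_alg L) p) z -> exists2 q : {poly K},
    size q = (adjoin_degree 1%AS z).+1 & q %| p /\ root (map_poly (in_alg L) q) z.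
Proof.
move=> pz; have /polyOver1P [q Dq] := minPolyOver 1%AS z.
exists q; first by rewrite -(size_map_poly (in_alg L)) -size_minPoly Dq.
rewrite -(dvdp_map (in_alg L)) -Dq root_minPoly minPoly_dvdp //.
by apply/polyOver1P; exists p.
Qed.

Lemma adjoin_degree1 (z : L) : adjoin_degree 1%AS z = 1 ->
  exists c : K, z = c%:A.
Proof.
move=> d1; have : z \in 1%AS by rewrite -adjoin_deg_eq1 d1.
by move/vlineP.
Qed.

Lemma root_neq0 (z : L) (c : K) (n : nat) :
  c != 0 -> z ^+ n.+1 = c%:A -> z != 0.
Proof.
move=> c0 Dz; apply: contraNneq c0 => z0; move: Dz.
by rewrite z0 expr0n -in_algE => /esym/eqP; rewrite fmorph_eq0.
Qed.

Lemma even_dim_sqrt (f : K) (s : L) :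
  (forall h, f <> h ^+ 2) -> s ^+ 2 = f%:A -> (2 %| \dim {:L})%N.
Proof.
move=> nsq_f Ds; apply: dvdn_trans (adjoin_degree_dvd s).
have [|q szq [q_p _]] := @minPoly_descent s ('X^2 - f%:P).
  by rewrite rmorphB rmorphXn /= map_polyX map_polyC /root !hornerE Ds subrr.
have: (adjoin_degree 1%AS s <= 2)%N.
  have := dvdp_leq _ q_p; rewrite szq size_XnsubC //; apply.
  by rewrite -size_poly_eq0 size_XnsubC.
case Ed: (adjoin_degree 1%AS s) => [|[|[|d]]] // _.
have [c Dc] := adjoin_degree1 Ed; case: (nsq_f c).
by apply: (fmorph_inj (in_alg L)); rewrite rmorphXn /= -Dc Ds.
Qed.

(** The degree of t divides the dimension of L and is at most 3.  If it were 1 or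
    2, then X^3 - X - g would have a linear factor over K. *)
Lemma dvd3_dim_artin_schreier (g : K) (t : L) :
  (forall h, g <> h ^+ 3 - h) -> t ^+ 3 - t = g%:A -> (3 %| \dim {:L})%N.
Proof.
move=> g_as Dt; apply: dvdn_trans (adjoin_degree_dvd t).
have szr : (size (- ('X + g%:P) : {poly K}) < 4)%N.
  by rewrite size_polyN size_XaddC.
pose p : {poly K} := 'X^3 - ('X + g%:P).
have szp : size p = 4 by rewrite /p size_polyDl ?size_polyXn.
have no_root c : ~~ root p c.
  apply/negP; rewrite /root !hornerE => /eqP pc; apply: (g_as c).
  by apply/eqP; rewrite -subr_eq0 -oppr_eq0 -pc; apply/eqP; ring.
have [|q szq [q_p _]] := @minPoly_descent t p.
  rewrite rmorphB rmorphD rmorphXn /= map_polyX map_polyC /root !hornerE.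
  by rewrite /= opprD addrA Dt subrr.
have: (adjoin_degree 1%AS t <= 3)%N.
  have := dvdp_leq _ q_p; rewrite szq szp; apply.
  by rewrite -size_poly_eq0 szp.
case Ed: (adjoin_degree 1%AS t) => [|[|[|[|d]]]] // _.
  have [c Dc] := adjoin_degree1 Ed; case: (g_as c).
  by apply: (fmorph_inj (in_alg L)); rewrite rmorphB rmorphXn /= -Dc Dt.
case/dvdpP: q_p => r Dp.
have r0 : r != 0 by apply/eqP => r0; move: szp; rewrite Dp r0 mul0r size_poly0.
have q0 : q != 0 by rewrite -size_poly_eq0 szq.
have /poly2_root [c rc] : size r = 2.
  by move: szp; rewrite Dp size_mul // szq Ed addn3 /= => -[].
by case/negP: (no_root c); rewrite Dp rootM rc.
Qed.

(** The square u^2 is a square root of f, so the dimension is even and only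
    dimension 2 has to be excluded.  There u satisfies u^2 = p u + r, so
    u^4 = p (p^2 + 2 r) u + (p^2 r + r^2); as this lies in K, either p = 0 and
    f = r^2, or p^2 = -2 r and f = -r^2.  Both are squares since -1 is one. *)
Lemma dim_quartic_root (f : K) (e : K) (u : L) :
  e ^+ 2 = -1 -> (forall h, f <> h ^+ 2) -> u ^+ 4 = f%:A ->
  (4 <= \dim {:L})%N.
Proof.
move=> De nsq_f Du.
have /dvdnP [m Dm] : (2 %| \dim {:L})%N.
  by apply: (@even_dim_sqrt f (u ^+ 2)) => //; rewrite -exprM.
have := adim_gt0 {:L}; rewrite Dm; case: m Dm => [|[|m]] // dimL _.
have u_deg2 : adjoin_degree 1%AS u = 2.
  have /(dvdn_leq _) : (adjoin_degree 1%AS u %| 2)%N.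
    by rewrite -[2%N]mul1n -dimL adjoin_degree_dvd.
  case Ed: (adjoin_degree 1%AS u) => [|[|[|d]]] // => [_|/(_ isT) //].
  have [c Dc] := adjoin_degree1 Ed; case: (nsq_f (c ^+ 2)).
  by apply: (fmorph_inj (in_alg L)); rewrite !rmorphXn /= -Dc -exprM Du.
have [|q szq [_ qu]] := @minPoly_descent u ('X^4 - f%:P).
  by rewrite rmorphB rmorphXn /= map_polyX map_polyC /root !hornerE Du subrr.
have q2 : q`_2 != 0.
  have -> : q`_2 = lead_coef q by rewrite lead_coefE szq u_deg2.
  by rewrite lead_coef_eq0 -size_poly_eq0 szq.
have [A AE] : exists A : {rmorphism K -> L}, forall c, c%:A = A c.
  by exists (in_alg L).
have q2L : A q`_2 != 0 by rewrite fmorph_eq0.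
pose p := - (q`_1 / q`_2); pose r := - (q`_0 / q`_2).
have Du2 : u ^+ 2 = A p * u + A r.
  move: qu; rewrite /root horner_coef size_map_poly szq u_deg2.
  rewrite !big_ord_recl big_ord0 !coef_map /= !AE /bump /=.
  rewrite /p /r !rmorphN !fmorph_div => /eqP qu.
  apply: (mulfI q2L); apply/eqP; rewrite -subr_eq0 -qu.
  by apply/eqP; field.
have uK c : u <> A c.
  rewrite -AE => Dc; have: adjoin_degree 1%AS u == 1.
    by rewrite adjoin_deg_eq1 Dc rpredZ ?rpred1.
  by rewrite u_deg2.
have Df : A f = A (p * (p ^+ 2 + r *+ 2)) * u + A (p ^+ 2 * r + r ^+ 2).
  rewrite -AE -Du -[4%N]/(2 * 2)%N exprM Du2.
  have -> : (A p * u + A r) ^+ 2 =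
     A p ^+ 2 * u ^+ 2 + A p * A r *+ 2 * u + A r ^+ 2 :> L by ring.
  by rewrite Du2; ring.
have [c0|c0] := eqVneq (p * (p ^+ 2 + r *+ 2)) 0.
  have {}Df : f = p ^+ 2 * r + r ^+ 2.
    by apply: (fmorph_inj A); rewrite Df c0 rmorph0 mul0r add0r.
  move/eqP: c0; rewrite mulf_eq0 => /orP[] /eqP p0.
    by case: (nsq_f r); rewrite Df p0 expr0n mul0r add0r.
  case: (nsq_f (e * r)); rewrite Df exprMn De.
  have -> : p ^+ 2 = - (r *+ 2) by apply/eqP; rewrite -subr_eq0 opprK p0.
  by ring.
case: (uK ((f - (p ^+ 2 * r + r ^+ 2)) / (p * (p ^+ 2 + r *+ 2)))).
have cL : A (p * (p ^+ 2 + r *+ 2)) != 0 by rewrite fmorph_eq0.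
by apply: (mulfI cL); rewrite fmorph_div rmorphB Df addrK mulrCA divff // mulr1.
Qed.

End Degrees.

(** * The coordinate ring of the affine curve y^2 = x^3 + a x + b *)

Section CoordinateRing.
Variables (k : fieldType) (a b : k).

Definition cubic : {poly k} := 'X^3 + (a *: 'X + b%:P).

Lemma size_cubic : size cubic = 4%N.
Proof.
rewrite /cubic size_polyDl ?size_polyXn // (leq_ltn_trans (size_polyD _ _)) //.
rewrite gtn_max (leq_ltn_trans (size_scale_leq _ _)) ?size_polyX //=.
by rewrite (leq_ltn_trans (size_polyC_leq1 _)).
Qed.

Definition affine_pt (M : fieldType) (i : {rmorphism k -> M}) (x y : M) :=
  y ^+ 2 = x ^+ 3 + i a * x + i b.

Lemma cubicE (M : fieldType) (i : {rmorphism k -> M}) (x : M) :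
  (map_poly i cubic).[x] = x ^+ 3 + i a * x + i b.
Proof.
rewrite /cubic !rmorphD /= linearZ /= map_polyXn map_polyX map_polyC.
by rewrite !hornerE.
Qed.

(** The coordinate ring k[x, y] / (y^2 - cubic x) is free over k[x] with basis
    1, y; the pair (s, t) stands for the function s + t y. *)
Definition regval (M : fieldType) (i : {rmorphism k -> M}) (x y : M)
  (q : {poly k} * {poly k}) : M := (map_poly i q.1).[x] + (map_poly i q.2).[x] * y.

Definition regmul (q r : {poly k} * {poly k}) : {poly k} * {poly k} :=
  (q.1 * r.1 + cubic * q.2 * r.2, q.1 * r.2 + q.2 * r.1).

(** The norm to k[x], that is (s + t y) (s - t y).  Its degree is the order of the
    pole of s + t y at infinity. *)
Definition regnorm (q : {poly k} * {poly k}) : {poly k} :=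
  q.1 ^+ 2 - q.2 ^+ 2 * cubic.

Lemma regvalD (M : fieldType) (i : {rmorphism k -> M}) x y q r :
  regval i x y (q.1 + r.1, q.2 + r.2) = regval i x y q + regval i x y r.
Proof. by rewrite /regval /= !rmorphD !hornerD; ring. Qed.

Lemma regvalM (M : fieldType) (i : {rmorphism k -> M}) x y q r :
  affine_pt i x y -> regval i x y (regmul q r) = regval i x y q * regval i x y r.
Proof.
move=> xyE; rewrite /regval /= !rmorphD !rmorphM !hornerD !hornerM cubicE -xyE.
by ring.
Qed.

Lemma regvalC (M : fieldType) (i : {rmorphism k -> M}) x y (c : k) :
  regval i x y (c%:P, 0) = i c.
Proof. by rewrite /regval /= rmorph0 map_polyC !hornerE. Qed.

Lemma regval_norm (M : fieldType) (i : {rmorphism k -> M}) x y q :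
  affine_pt i x y ->
  regval i x y q * regval i x y (q.1, - q.2) = (map_poly i (regnorm q)).[x].
Proof.
move=> xyE; rewrite /regval /regnorm /= rmorphN rmorphB !rmorphM /=.
by rewrite !hornerE cubicE -xyE /=; ring.
Qed.

Lemma regnormM q r : regnorm (regmul q r) = regnorm q * regnorm r.
Proof. by rewrite /regnorm /regmul /=; ring. Qed.

Lemma size_sqr (p : {poly k}) :
  size (p ^+ 2) = (2 * size p).-1.
Proof.
have [->|p0] := eqVneq p 0; first by rewrite expr0n /= size_poly0.
by rewrite expr2 size_mul // mul2n addnn.
Qed.

(** If size p = n then p^2 * cubic has size odd_size n: its degree, when p is
    nonzero, is 2 deg p + 3. *)
Definition odd_size (n : nat) := if n == 0%N then 0%N else (2 * n + 2)%N.

Lemma size_sqr_cubic (p : {poly k}) :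
  size (p ^+ 2 * cubic) = odd_size (size p).
Proof.
rewrite /odd_size size_poly_eq0.
have [->|p0] := eqVneq p 0; first by rewrite expr0n mul0r size_poly0.
have c0 : cubic != 0 by rewrite -size_poly_eq0 size_cubic.
rewrite size_mul ?expf_neq0 // size_sqr size_cubic.
have := p0; rewrite -size_poly_eq0; lia.
Qed.

(** The two terms of the norm have degrees of different parity, so their leading
    terms never cancel. *)
Lemma size_regnorm q :
  size (regnorm q) = maxn (2 * size q.1).-1 (odd_size (size q.2)).
Proof.
rewrite /regnorm.
have [lt_sz|lt_sz|eq_sz] := ltngtP (2 * size q.1).-1 (odd_size (size q.2)).
- by rewrite addrC size_polyDl size_polyN size_sqr_cubic ?size_sqr.
- by rewrite size_polyDl ?size_polyN ?size_sqr_cubic size_sqr.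
- move: eq_sz; rewrite /odd_size; case: eqP => [sz0 _|]; last by lia.
  have -> : q.2 = 0 by apply/eqP; rewrite -size_poly_eq0 sz0.
  by rewrite expr0n mul0r subr0 size_sqr.
Qed.

Lemma regnorm_eq0 q : regnorm q = 0 -> q = (0, 0).
Proof.
move=> q0; have := size_regnorm q; rewrite q0 size_poly0 /odd_size => sz.
have s1 : size q.1 = 0%N by move: sz; case: eqP; lia.
have s2 : size q.2 = 0%N by move: sz; case: eqP; lia.
case: q s1 s2 {q0 sz} => q1 q2 /= /eqP + /eqP.
by rewrite !size_poly_eq0 => /eqP -> /eqP ->.
Qed.

(** A point of the curve that satisfies no relation other than those that hold at
    every point.  Computing with it replaces computing in the function field. *)
Definition generic (M : fieldType) (i : {rmorphism k -> M}) (x y : M) :=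
  affine_pt i x y /\ forall q, regval i x y q = 0 -> q = (0, 0).

(** Adjoin to k(x) a square root y of the cubic.  If s + t y vanishes, so does its
    norm, a polynomial in the transcendental x. *)
Lemma generic_point :
  exists (M : fieldType) (i : {rmorphism k -> M}) (x y : M), generic i x y.
Proof.
pose F : fieldType := {fraction {poly k}}.
pose tF : {rmorphism {poly k} -> F} := @FracField.tofrac _.
have [|L [y [_ yc]]] := @extension_with_root F ('X^2 - (tF cubic)%:P).
  by rewrite size_XnsubC.
pose i : {rmorphism k -> L} := in_alg L \o (tF \o polyC).
pose x : L := in_alg L (tF 'X).
have ev_x (p : {poly k}) : (map_poly i p).[x] = in_alg L (tF p).
  rewrite /i map_poly_comp /x horner_map map_poly_comp horner_map.
  by congr (in_alg L (tF _)); apply: comp_polyXr.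
have xyE : affine_pt i x y.
  apply/eqP; rewrite -subr_eq0 -cubicE ev_x -[X in _ == X](eqP yc).
  by rewrite rmorphB rmorphXn /= map_polyX map_polyC !hornerE.
exists L, i, x, y; split=> // q q0; apply: regnorm_eq0.
have := regval_norm q xyE; rewrite q0 mul0r ev_x => /esym/eqP.
by rewrite fmorph_eq0 /tF /= tofrac_eq0 => /eqP.
Qed.

End CoordinateRing.

Lemma regval_inj (k : fieldType) (a b : k) (M : fieldType)
    (i : {rmorphism k -> M}) (x y : M) (q r : {poly k} * {poly k}) :
  generic a b i x y -> regval i x y q = regval i x y r -> q = r.
Proof.
case=> _ gen Eqr; have /gen : regval i x y (q.1 - r.1, q.2 - r.2) = 0.
  have := subrr (regval i x y q); rewrite {2}Eqr => <-.
  by rewrite /regval /= !rmorphB !hornerE; ring.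
case: q r {Eqr} => [q1 q2] [r1 r2] /= [/eqP + /eqP].
by rewrite !subr_eq0 => /eqP -> /eqP ->.
Qed.

(** * Functions regular at every affine point *)

Section Regularity.
Variables (k : fieldType) (a b : k).
Hypothesis two_neq0 : (2 : k) != 0.

Definition pt (M : fieldType) (x y z : M) : 'I_3 -> M := fun j => [:: x; y; z]`_j.

(** Reducing the polynomial modulo y^2 = x^3 + a x + b gives one pair that is good
    for all points over all fields.  So a relation found at a generic point can be
    specialised to any other point. *)
Lemma ev_affine_regval (G : {mpoly k[3]}) :
  exists q, forall (M : fieldType) (i : {rmorphism k -> M}) (x y : M),
    affine_pt a b i x y -> ev i (pt x y 1) G = regval i x y q.
Proof.
pose C (G : {mpoly k[3]}) :=
  exists q, forall (M : fieldType) (i : {rmorphism k -> M}) (x y : M),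
    affine_pt a b i x y -> ev i (pt x y 1) G = regval i x y q.
have CM G1 G2 : C G1 -> C G2 -> C (G1 * G2).
  move=> [q Hq] [r Hr]; exists (regmul a b q r) => M i x y xyE.
  by rewrite regvalM // -Hq // -Hr // /ev rmorphM mevalM.
have CD G1 G2 : C G1 -> C G2 -> C (G1 + G2).
  move=> [q Hq] [r Hr]; exists (q.1 + r.1, q.2 + r.2) => M i x y xyE.
  by rewrite regvalD // -Hq // -Hr // /ev rmorphD mevalD.
have CC c : C c%:MP.
  exists (c%:P, 0) => M i x y xyE.
  by rewrite regvalC /ev map_mpolyC mevalC.
have CX j : C 'X_j.
  have evX (M : fieldType) (i : {rmorphism k -> M}) P : ev i P 'X_j = P j.
    by rewrite /ev map_mpolyX mevalXU.
  have : (j : nat) \in [:: 0%N; 1%N; 2%N] by case: j {evX} => [[|[|[|]]]].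
  rewrite !inE => /or3P[] /eqP Dj.
  - exists ('X, 0) => M i x y xyE; rewrite evX /pt Dj /regval /=.
    by rewrite map_polyX rmorph0 !hornerE.
  - exists (0, 1) => M i x y xyE; rewrite evX /pt Dj /regval /=.
    by rewrite rmorph0 rmorph1 !hornerE.
  - exists (1, 0) => M i x y xyE; rewrite evX /pt Dj /regval /=.
    by rewrite rmorph0 rmorph1 !hornerE.
rewrite -/(C G) [G]mpolyE; apply: (big_ind C) => [||m _].
- by rewrite -mpolyC0; apply: CC.
- exact: CD.
- rewrite -mul_mpolyC; apply: (CM) => //; rewrite mpolyXE_id.
  apply: (big_ind C) => [||j _]; first by rewrite -mpolyC1; apply: CC.
    exact: CM.
  by elim: (m j) => [|n IHn]; rewrite ?exprS; [rewrite expr0 -mpolyC1 |apply: CM].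
Qed.

Lemma affine_pt_over (M : fieldType) (i : {rmorphism k -> M}) (x : M) :
  exists (M' : fieldType) (i' : {rmorphism M -> M'}) (y : M'),
    affine_pt a b (i' \o i) (i' x) y.
Proof.
have [|L [y [_ yc]]] :=
  @extension_with_root M ('X^2 - ((map_poly i (cubic a b)).[x])%:P).
  by rewrite size_XnsubC.
exists L, (in_alg L), y; rewrite /affine_pt.
move: yc; rewrite /root rmorphB rmorphXn /= map_polyX map_polyC !hornerE.
rewrite subr_eq0 => /eqP ->; rewrite cubicE /= -!/(in_alg L _).
by rewrite !rmorphD rmorphXn rmorphM.
Qed.

(** The intersection of the local rings of the affine curve is its coordinate ring.
    Write h = q / d with d in k[x] of least degree.  If d is not constant, it has a
    root z in some extension; let (z, w) and (z, -w) be the points above it.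
    Regularity of h at both points makes both components of q vanish at z.  Hence d
    and the components of q have a nontrivial common divisor, and d can be
    shortened.  Characteristic 2 is excluded so that the two points separate the
    components. *)
Lemma regular_everywhere (M : fieldType) (i : {rmorphism k -> M}) (x y h : M) :
  generic a b i x y ->
  (forall (M' : fieldType) (i' : {rmorphism k -> M'}) (x' y' : M'),
     affine_pt a b i' x' y' -> exists q r,
     regval i' x' y' r != 0 /\ regval i x y r * h = regval i x y q) ->
  exists q, h = regval i x y q.
Proof.
move=> gen_xy regh; have [xyE gen] := gen_xy.
have inj1 (p : {poly k}) : p != 0 -> (map_poly i p).[x] != 0.
  apply: contra => /eqP p0; have /gen [->] // : regval i x y (p, 0) = 0.
  by rewrite /regval /= p0 rmorph0 horner0 mul0r addr0.
(* Induction on the size of the denominator; the first denominator is a norm. *)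
suff den (n : nat) (d : {poly k}) q : (size d <= n)%N -> d != 0 ->
    (map_poly i d).[x] * h = regval i x y q -> exists q, h = regval i x y q.
  have [q [r [r0 hr]]] := regh M i x y xyE.
  apply: (den _ (regnorm a b r) (regmul a b q (r.1, - r.2)) (leqnn _)).
    apply: contra r0 => /eqP; rewrite /regnorm => /regnorm_eq0 ->.
    by rewrite /regval /= rmorph0 horner0 mul0r addr0.
  by rewrite -(regval_norm r xyE) regvalM // -hr; ring.
elim: n d q => [|n IHn] d q.
  by rewrite leqn0 size_poly_eq0 => ->.
move=> le_dn d0 hd; have [d1|d1] := eqVneq (size d) 1%N.
  have /eqP/size_poly1P [c c0 Dd] := d1.
  exists (c^-1%:P * q.1, c^-1%:P * q.2); rewrite /regval /= !rmorphM !hornerM.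
  have ic0 : i c != 0 by rewrite fmorph_eq0.
  rewrite /= map_polyC hornerC /= -mulrA -mulrDr fmorphV; apply: (mulfI ic0).
  rewrite mulVKf // -/(regval i x y q) -hd Dd map_polyC hornerC //.
have [|L [z [_ dz]]] := @extension_with_root k d.
  by rewrite ltn_neqAle eq_sym d1 size_poly_gt0.
have [M' [i' [w zwE]]] := affine_pt_over (in_alg L) z.
pose i1 : {rmorphism k -> M'} := i' \o in_alg L.
pose z1 := i' z.
have root_i1 p : root (map_poly (in_alg L) p) z = ((map_poly i1 p).[z1] == 0).
  by rewrite map_poly_comp horner_map fmorph_eq0.
have zwE' : affine_pt a b i1 z1 (- w) by rewrite /affine_pt sqrrN.
(* If h = u / v with v invertible at (z, w'), then d u = v q; evaluate at z. *)
have annih w' : affine_pt a b i1 z1 w' ->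
    (map_poly i1 q.1).[z1] + (map_poly i1 q.2).[z1] * w' = 0
    /\ (w' = 0 -> (map_poly i1 q.2).[z1] = 0).
  move=> E'; have [u [v [v0 hv]]] := regh _ _ _ _ E'.
  have Duv : regmul a b v q = (d * u.1, d * u.2).
    apply: (regval_inj gen_xy); rewrite (regvalM _ _ xyE) -hd mulrCA hv.
    by rewrite /regval /= !rmorphM !hornerM; ring.
  have dz1 : (map_poly i1 d).[z1] = 0 by apply/eqP; rewrite -root_i1.
  split.
    apply: (mulfI v0); rewrite mulr0 -[X in _ * X]/(regval i1 z1 w' q).
    rewrite -(regvalM _ _ E') Duv.
    by rewrite /regval /= !rmorphM !hornerM dz1 !mul0r addr0.
  move=> w'0; have := congr1 (fun s => (map_poly i1 s.2).[z1]) Duv.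
  have v1 : (map_poly i1 v.1).[z1] != 0.
    by move: v0; rewrite /regval w'0 mulr0 addr0.
  have q1 : (map_poly i1 q.1).[z1] = 0.
    have := congr1 (fun s => (map_poly i1 s.1).[z1]) Duv.
    rewrite /= rmorphD !rmorphM !hornerE /= cubicE -E' w'0 dz1.
    by rewrite expr0n !mul0r addr0 => /eqP; rewrite mulf_eq0 (negPf v1) => /eqP.
  rewrite /= rmorphD !rmorphM !hornerE /= dz1 q1 mul0r mulr0 addr0 => /eqP.
  by rewrite mulf_eq0 (negPf v1) => /eqP.
have [A0 B0] := annih _ zwE; have [A0' _] := annih _ zwE'.
have q1z : (map_poly i1 q.1).[z1] = 0.
  have /eqP : i1 2 * (map_poly i1 q.1).[z1] = 0.
    by rewrite -[RHS](addr0 0) -{1}A0 -A0' rmorphMn rmorph1; ring.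
  by rewrite mulf_eq0 fmorph_eq0 (negPf two_neq0) => /eqP.
have q2z : (map_poly i1 q.2).[z1] = 0.
  move/eqP: A0; rewrite q1z add0r mulf_eq0 => /orP[/eqP //|/eqP].
  exact: B0.
pose e := gcdp d (gcdp q.1 q.2).
have ez : root (map_poly (in_alg L) e) z.
  by rewrite !gcdp_map !root_gcd dz !root_i1 q1z q2z eqxx.
have [d' Dd] : exists d', d = d' * e by apply/dvdpP; rewrite dvdp_gcdl.
have [q1' Dq1] : exists q1', q.1 = q1' * e.
  by apply/dvdpP; apply: dvdp_trans (dvdp_gcdr _ _) (dvdp_gcdl _ _).
have [q2' Dq2] : exists q2', q.2 = q2' * e.
  by apply/dvdpP; apply: dvdp_trans (dvdp_gcdr _ _) (dvdp_gcdr _ _).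
have [d'0 e0] : d' != 0 /\ e != 0.
  by move: d0; rewrite Dd mulf_eq0 negb_or => /andP.
apply: (IHn d' (q1', q2')) => //.
  have e_gt1 : (1 < size e)%N.
    rewrite -(size_map_poly (in_alg L)); apply: root_size_gt1 ez.
    by rewrite map_poly_eq0.
  have := size_mul d'0 e0; rewrite -Dd; move: le_dn e_gt1.
  by move: (size d) (size d') (size e) => ? ? ?; lia.
apply: (mulfI (inj1 _ e0)); move: hd; rewrite /regval Dd Dq1 Dq2 /= !rmorphM !hornerM.
by move=> hd; rewrite mulrA [_ * (map_poly i d').[x]]mulrC hd; ring.
Qed.

End Regularity.

(** * Poles at infinity and changes of coordinates *)

(** The substitution x' = u^2 x + s, y' = u^3 y takes y^2 = x^3 + a x + b to
    y'^2 = x'^3 + a' x' + b' in characteristic 3, where cubing is additive. *)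
Definition change_of_coordinates (k : fieldType) (a b a' b' u s : k) :=
  [/\ u != 0, u ^+ 4 * a = a' & u ^+ 6 * b = s ^+ 3 + a' * s + b'].

Lemma char3_two_neq0 (k : fieldType) : 3 \in [pchar k] -> (2 : k) != 0.
Proof.
move=> char3; apply/eqP => two0; have /eqP := oner_neq0 k; apply.
have -> : 1 = 3 - 2 :> k by ring.
by rewrite two0 subr0; apply: pcharf0.
Qed.

Lemma poly4_eq0 (k : fieldType) (c0 c1 c2 c3 : k) :
  c3%:P * 'X^3 + c2%:P * 'X^2 + c1%:P * 'X + c0%:P = 0 ->
  [/\ c3 = 0, c2 = 0, c1 = 0 & c0 = 0].
Proof.
move=> E; have c n := congr1 (fun p : {poly k} => p`_n) E.
by split; [have := c 3%N | have := c 2%N | have := c 1%N | have := c 0%N];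
  rewrite !coefE /= !(mulr0, mulr1, addr0, add0r).
Qed.

Section PoleOrder.
Variables (k : fieldType) (a b : k) (M : fieldType) (i : {rmorphism k -> M}).
Variables (x y : M).
Hypothesis xy_gen : generic a b i x y.

(** The order of the pole of h at infinity, for a generic point (x, y); it is
    undefined for h = 0. *)
Definition pole_order (h : M) (n : nat) :=
  exists2 q, h = regval i x y q & size (regnorm a b q) = n.+1.

Lemma pole_order_neq0 h n : pole_order h n -> h != 0.
Proof.
case=> q -> szq; apply/eqP => q0; move: szq.
have -> : q = (0, 0) by case: xy_gen => _; apply.
by rewrite size_regnorm /= size_poly0.
Qed.

Lemma pole_order_uniq h m n : pole_order h m -> pole_order h n -> m = n.
Proof. by move=> [q -> szq] [r /(regval_inj xy_gen) <-]; rewrite szq => -[]. Qed.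

Lemma pole_order_reg q : q != (0, 0) -> exists n, pole_order (regval i x y q) n.
Proof.
move=> q0; exists (size (regnorm a b q)).-1; exists q => //.
rewrite prednK // lt0n size_poly_eq0.
by apply: contraNneq q0 => /regnorm_eq0 ->.
Qed.

Lemma pole_orderM h h' m n :
  pole_order h m -> pole_order h' n -> pole_order (h * h') (m + n).
Proof.
case: xy_gen => xyE _ [q -> szq] [r -> szr].
exists (regmul a b q r); first by rewrite (regvalM _ _ xyE).
rewrite regnormM size_mul ?szq ?szr ?addSn ?addnS //.
  by rewrite -size_poly_eq0 szq.
by rewrite -size_poly_eq0 szr.
Qed.

Lemma pole_orderDl h h' m n :
  pole_order h m -> pole_order h' n -> (n < m)%N -> pole_order (h + h') m.
Proof.
move=> [q -> szq] [r -> szr] lt_nm.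
exists (q.1 + r.1, q.2 + r.2); first by rewrite regvalD.
move: szq szr; rewrite !size_regnorm /odd_size /=.
have := size_polyD q.1 r.1; have := size_polyD q.2 r.2.
have := @size_polyDl _ q.1 r.1; have := @size_polyDl _ q.2 r.2.
move: (size (q.1 + r.1)%R) (size (q.2 + r.2)%R).
move: (size q.1) (size q.2) (size r.1) (size r.2) => q1 q2 r1 r2 s1 s2.
by do !case: eqP => ?; lia.
Qed.

Lemma pole_order_const (c : k) : c != 0 -> pole_order (i c) 0.
Proof.
move=> c0; exists (c%:P, 0); first by rewrite regvalC.
by rewrite size_regnorm /= size_polyC c0 size_poly0.
Qed.

Lemma pole_order_x : pole_order x 2.
Proof.
exists ('X, 0); first by rewrite /regval /= rmorph0 map_polyX !hornerE.
by rewrite size_regnorm /= size_polyX size_poly0.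
Qed.

Lemma pole_order_y : pole_order y 3.
Proof.
exists (0, 1); first by rewrite /regval /= rmorph0 rmorph1 !hornerE.
by rewrite size_regnorm /= size_poly1 size_poly0.
Qed.

Lemma pole_order_poly h n (p : {poly k}) : (0 < n)%N -> pole_order h n ->
  p != 0 -> pole_order (map_poly i p).[h] ((size p).-1 * n).
Proof.
move=> n_gt0 hn; elim/poly_ind: p => [|p c IHp]; first by rewrite eqxx.
rewrite -size_poly_eq0 size_MXaddC; case: ifP => // pc0 _.
rewrite rmorphD rmorphM /= map_polyX map_polyC !hornerE /=.
have [p0|p0] := eqVneq p 0.
  move: pc0; rewrite p0 eqxx /= rmorph0 horner0 mul0r add0r size_poly0.
  by move/negbT; apply: pole_order_const.
have phn : pole_order ((map_poly i p).[h] * h) (size p * n).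
  rewrite -[size p]prednK ?lt0n ?size_poly_eq0 // mulSn addnC.
  by apply: pole_orderM => //; apply: IHp.
have [->|c0] := eqVneq c 0; first by rewrite rmorph0 addr0.
apply: (pole_orderDl phn (pole_order_const c0)).
by rewrite muln_gt0 n_gt0 lt0n size_poly_eq0 p0.
Qed.

Lemma pole_order_norm q n :
  pole_order (regval i x y q) n -> size (regnorm a b q) = n.+1.
Proof. by case=> r /(regval_inj xy_gen) ->. Qed.

(** The monomials xi^j and xi^j eta have poles of distinct orders, all of them
    multiples of m, so a polynomial in xi and eta has the order of one of its
    monomials. *)
Lemma dvdn_pole_order xi eta m q n : (0 < m)%N ->
  pole_order xi (2 * m) -> pole_order eta (3 * m) ->
  pole_order (regval i xi eta q) n -> (m %| n)%N.
Proof.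
move=> m_gt0 xi_m eta_m qn.
have m2_gt0 : (0 < 2 * m)%N by rewrite muln_gt0.
have pxi := pole_order_poly m2_gt0 xi_m.
have [q2_0|q2_0] := eqVneq q.2 0.
  have [q1_0|q1_0] := eqVneq q.1 0.
    have := pole_order_neq0 qn.
    by rewrite /regval q1_0 q2_0 !rmorph0 !horner0 mul0r addr0 eqxx.
  move: qn; rewrite /regval q2_0 rmorph0 horner0 mul0r addr0.
  by move/(pole_order_uniq (pxi _ q1_0)) <-; rewrite mulnA dvdn_mull.
have o2 := pole_orderM (pxi _ q2_0) eta_m.
have [q1_0|q1_0] := eqVneq q.1 0.
  move: qn; rewrite /regval q1_0 rmorph0 horner0 add0r.
  by move/(pole_order_uniq o2) <-; rewrite mulnA -mulnDl dvdn_mull.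
have o1 := pxi _ q1_0; rewrite !mulnA -?mulnDl in o1 o2.
have [lt12|lt21|] := ltngtP ((size q.1).-1 * 2) ((size q.2).-1 * 2 + 3).
- have := pole_orderDl o2 o1; rewrite ltn_pmul2r // addrC => /(_ lt12).
  by move/(pole_order_uniq qn) ->; rewrite dvdn_mull.
- have := pole_orderDl o1 o2; rewrite ltn_pmul2r // => /(_ lt21).
  by move/(pole_order_uniq qn) ->; rewrite dvdn_mull.
- lia.
Qed.

(** The equation gives xi and eta poles of orders 2 m and 3 m.  Since x and y are
    polynomials in xi and eta, m divides their orders 2 and 3.  The case of a
    constant xi is separate: then eta and x would be constant as well. *)
Lemma pole_orders_of_generators (a' b' : k) q r q' r' :
  let xi := regval i x y q in let eta := regval i x y r in
  eta ^+ 2 = xi ^+ 3 + i a' * xi + i b' ->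
  x = regval i xi eta q' -> y = regval i xi eta r' ->
  pole_order xi 2 /\ pole_order eta 3.
Proof.
move=> xi eta; rewrite -cubicE => etaE Dx Dy.
have const_reg s : (size (regnorm a b s) <= 1)%N -> exists c, s = (c%:P, 0).
  rewrite size_regnorm /odd_size => szs.
  have s2 : s.2 = 0.
    by apply/eqP; rewrite -size_poly_eq0; move: szs; case: eqP => //; lia.
  have /size1_polyC s1 : (size s.1 <= 1)%N by lia.
  by exists s.1`_0; case: s {szs} s1 s2 => /= s1 s2 {1}-> ->.
have x_nonconst c : x <> i c.
  have [s Dx' szs] := pole_order_x.
  rewrite -(regvalC i x y) {1}Dx' => /(regval_inj xy_gen) Ds; move: szs.
  by rewrite Ds size_regnorm /odd_size /= size_poly0 /= size_polyC; case: eqP.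
have [n xin] : exists n, pole_order xi n.+1.
  case: (leqP (size (regnorm a b q)) 1); last first.
    by move=> q_gt1; exists (size (regnorm a b q)).-2; exists q => //; lia.
  case/const_reg => c Dq.
  have xic : xi = i c by rewrite /xi Dq regvalC.
  have [e etae] : exists e, eta = i e.
    have Drr : regmul a b r r = ((cubic a' b').[c]%:P, 0).
      apply: (regval_inj xy_gen); rewrite (regvalM _ _ (proj1 xy_gen)) regvalC.
      by rewrite -expr2 -/eta etaE xic horner_map.
    have /const_reg [e Dr] : (size (regnorm a b r) <= 1)%N.
      have [->|r0] := eqVneq (regnorm a b r) 0; first by rewrite size_poly0.
      have := size_regnorm a b (regmul a b r r).
      rewrite {1}regnormM Drr /= size_poly0 /=.
      have := size_polyC_leq1 (cubic a' b').[c].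
      rewrite size_mul //; move: r0; rewrite -size_poly_eq0.
      by rewrite maxn0; move: (size (regnorm a b r)) (size _%:P) => ? ?; lia.
    by exists e; rewrite /eta Dr regvalC.
  case: (x_nonconst (q'.1.[c] + q'.2.[c] * e)).
  by rewrite {1}Dx xic etae /regval !horner_map -rmorphM -rmorphD.
have sz' : size (cubic a' b') = 4%N by apply: size_cubic.
have eta2n : pole_order (eta ^+ 2) (3 * n.+1).
  have := @pole_order_poly xi n.+1 (cubic a' b') isT xin.
  by rewrite sz' -etaE; apply; rewrite -size_poly_eq0 sz'.
have [e etae] : exists e, pole_order eta e.
  apply: pole_order_reg; apply/eqP => r0; have := pole_order_neq0 eta2n.
  by rewrite /eta r0 /regval /= rmorph0 horner0 mul0r addr0 expr0n eqxx.
have E23 := pole_order_uniq eta2n (pole_orderM etae etae).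
have [m Dn De] : exists2 m, n.+1 = (2 * m)%N & e = (3 * m)%N.
  by exists (e - n.+1)%N; lia.
have m_gt0 : (0 < m)%N by lia.
rewrite Dn in xin; rewrite De in etae.
have m2 : (m %| 2)%N.
  apply: (dvdn_pole_order (q := q') m_gt0 xin etae); rewrite -Dx.
  exact: pole_order_x.
have m3 : (m %| 3)%N.
  apply: (dvdn_pole_order (q := r') m_gt0 xin etae); rewrite -Dy.
  exact: pole_order_y.
have m1 : m = 1%N.
  by apply/eqP; rewrite -dvdn1 -[1%N]/(gcdn 2 3) dvdn_gcd m2 m3.
by move: xin etae; rewrite m1.
Qed.

(** Poles of orders 2 and 3 mean xi = al x + be and eta = c y + de x + ep with al
    and c nonzero.  Comparing coefficients in the equation between them gives
    de = ep = 0 because 2 is invertible, c^2 = al^3, and then the formulas for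
    u = c / al. *)
Lemma coordinate_change (a' b' : k) q r q' r' :
  3 \in [pchar k] ->
  let xi := regval i x y q in let eta := regval i x y r in
  eta ^+ 2 = xi ^+ 3 + i a' * xi + i b' ->
  x = regval i xi eta q' -> y = regval i xi eta r' ->
  exists u s : k, change_of_coordinates a b a' b' u s.
Proof.
move=> char3 xi eta etaE Dx Dy.
have [xi2 eta3] := pole_orders_of_generators etaE Dx Dy.
have := pole_order_norm xi2; have := pole_order_norm eta3.
rewrite !size_regnorm /odd_size => szr szq.
have szr2 : size r.2 = 1%N by move: szr; do !case: eqP => //; lia.
have szr1 : (size r.1 <= 2)%N by move: szr; do !case: eqP => //; lia.
have szq2 : size q.2 = 0%N by move: szq; do !case: eqP => //; lia.
have szq1 : size q.1 = 2%N by move: szq; rewrite szq2 /=; lia.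
have /eqP := szq2; rewrite size_poly_eq0 => /eqP q2.
have /eqP/size_poly1P [c c0 r2] := szr2.
have lin (p : {poly k}) : (size p <= 2)%N -> p = p`_1 *: 'X + (p`_0)%:P.
  move=> p2; apply/polyP => n; rewrite coefD coefZ coefX coefC.
  case: n => [|[|n]] /=; rewrite ?mulr0 ?mulr1 ?add0r ?addr0 //.
  by apply: nth_default; apply: leq_trans p2 _.
have := lin _ szr1; have := lin q.1; rewrite szq1 => /(_ isT).
have : q.1`_1 != 0.
  have -> : q.1`_1 = lead_coef q.1 by rewrite lead_coefE szq1.
  by rewrite lead_coef_eq0 -size_poly_eq0 szq1.
move: q.1`_1 q.1`_0 r.1`_1 r.1`_0 => al be de ep al0 q1 r1.
have three0 : (3 : k) = 0 by apply: pcharf0.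
have two0 := char3_two_neq0 char3.
have : regmul a b r r = (q.1 ^+ 3 + (a'%:P * q.1 + b'%:P), 0).
  apply: (regval_inj xy_gen); rewrite (regvalM _ _ (proj1 xy_gen)) -expr2.
  rewrite -/eta etaE /xi /regval /=.
  rewrite q2 !rmorph0 !horner0 !mul0r !addr0 !rmorphD !rmorphM /=.
  by rewrite !map_polyC !hornerE /=; ring.
rewrite /regmul r2 => -[]; rewrite [c%:P * _]mulrC -mulrDl.
move=> e1 /eqP; rewrite mulf_eq0 polyC_eq0 (negPf c0) orbF => /eqP e2.
have {}e2 : r.1 = 0.
  apply/eqP; move/eqP: e2; rewrite -mulr2n -scaler_nat scaler_eq0.
  by rewrite (negPf two0).
have three0P : (3 : {poly k}) = 0 by rewrite -[3]/(3%:R) -polyC_natr three0.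
have {}e1 : (c ^+ 2 - al ^+ 3)%:P * 'X^3 + 0%:P * 'X^2 +
    (c ^+ 2 * a - a' * al)%:P * 'X +
    (c ^+ 2 * b - (be ^+ 3 + a' * be + b'))%:P = 0.
  move/eqP: e1; rewrite e2 mul0r add0r -subr_eq0 /cubic q1 => /eqP E1.
  rewrite -[RHS]E1 -!mul_polyC.
  apply/eqP; rewrite -subr_eq0; apply/eqP.
  (* The two sides differ by the mixed terms of the cube of al X + be. *)
  transitivity (3 * (al%:P * be%:P * 'X * (al%:P * 'X + be%:P)) : {poly k}).
    by ring.
  by rewrite three0P mul0r.
have [/eqP c3 _ /eqP c1 /eqP c00] := poly4_eq0 e1.
move: c3 c1 c00; rewrite !subr_eq0 => /eqP c3 /eqP c1 /eqP c00.
exists (c / al), be; split.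
- by rewrite mulf_neq0 ?invr_neq0.
- apply: (mulfI al0); rewrite [al * a']mulrC -c1.
  by rewrite -[4%N]/(2 * 2)%N exprM expr_div_n c3; field.
- rewrite -c00; congr (_ * _).
  by rewrite -[6%N]/(2 * 3)%N exprM expr_div_n c3 exprS; field.
Qed.

End PoleOrder.

(** * Projective points of Weierstrass curves *)

Section Points.
Variables (k : fieldType) (M : fieldType) (i : {rmorphism k -> M}).

Lemma evE N (P : 'I_N.+1 -> M) (G : {mpoly k[N.+1]}) :
  ev i P G = \sum_(m <- msupp G) i G@_m * \prod_j P j ^+ m j.
Proof.
rewrite {1}[G]mpolyE /ev (rmorph_sum (map_mpoly i)) (rmorph_sum (meval P)) /=.
apply: eq_bigr => m _.
by rewrite map_mpolyZ map_mpolyX mevalZ mevalX.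
Qed.

Lemma ev_homog N (P Q : 'I_N.+1 -> M) c d (G : {mpoly k[N.+1]}) :
  G \is d.-homog -> (forall j, Q j = c * P j) -> ev i Q G = c ^+ d * ev i P G.
Proof.
move=> /dhomogP homG QP; rewrite !evE mulr_sumr big_seq [RHS]big_seq.
apply: eq_bigr => m /homG /= <-; rewrite mulrCA; congr (_ * _).
rewrite mdegE -prodrXr -big_split /=; apply: eq_bigr => j _.
by rewrite QP exprMn.
Qed.

Lemma ev_base_change N (P : 'I_N.+1 -> k) (G : {mpoly k[N.+1]}) :
  ev i (i \o P) G = i (ev (idfun : {rmorphism k -> k}) P G).
Proof.
rewrite /ev; transitivity (i G.@[P]); last first.
  by congr (i _.@[P]); apply/mpolyP => m; rewrite mcoeff_map_mpoly.
rewrite -/(ev i _ G) evE mevalE rmorph_sum; apply: eq_bigr => m _.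
rewrite rmorphM rmorph_prod; congr (_ * _); apply: eq_bigr => j _.
by rewrite rmorphXn.
Qed.

Lemma ev_wform (a b : k) (P : 'I_3 -> M) :
  ev i P (wform (short_weierstrass a b)) =
  P 1 ^+ 2 * P 2 - (P 0 ^+ 3 + i a * P 0 * P 2 ^+ 2 + i b * P 2 ^+ 3).
Proof.
rewrite /ev /wform /= !scale0r !addr0 !(rmorphB, rmorphD, rmorphM, rmorphXn) /=.
by rewrite -!mul_mpolyC !(rmorphM, rmorphXn) /= !map_mpolyC !map_mpolyX
   !mevalC !mevalXU; ring.
Qed.

Lemma samept_refl N (P : 'I_N.+1 -> M) : (exists j, P j != 0) -> samept P P.
Proof.
by move=> P0; split=> //; exists 1; rewrite ?oner_neq0 // => j; rewrite mul1r.
Qed.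

Lemma samept_neq0 N (P Q : 'I_N.+1 -> M) : samept P Q -> exists j, Q j != 0.
Proof. by case=> [[j Pj] [c c0 QP]]; exists j; rewrite QP mulf_neq0. Qed.

Lemma on_wcurveP (a b : k) (P : 'I_3 -> M) :
  on (wcurve (short_weierstrass a b)) i P <->
  (exists j, P j != 0) /\
  P 1 ^+ 2 * P 2 = P 0 ^+ 3 + i a * P 0 * P 2 ^+ 2 + i b * P 2 ^+ 3.
Proof.
split=> [[P0 onP] | [P0 EP]]; split=> //.
  by apply/eqP; rewrite -subr_eq0 -ev_wform onP.
by move=> _ ->; rewrite ev_wform EP subrr.
Qed.

Lemma on_affine (a b : k) (x y : M) :
  on (wcurve (short_weierstrass a b)) i (pt x y 1) <-> affine_pt a b i x y.
Proof.
rewrite on_wcurveP /pt /affine_pt /= !expr1n !mulr1; split=> [[]//|xyE].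
by split=> //; exists 2; rewrite oner_neq0.
Qed.

Lemma on_samept (a b : k) (P Q : 'I_3 -> M) :
  samept P Q -> on (wcurve (short_weierstrass a b)) i P ->
  on (wcurve (short_weierstrass a b)) i Q.
Proof.
move=> PQ; have Q0 := samept_neq0 PQ; case: PQ => [_ [c c0 QP]].
rewrite !on_wcurveP => -[_ EP]; split=> //; rewrite !QP.
have -> : (c * P 1) ^+ 2 * (c * P 2) = c ^+ 3 * (P 1 ^+ 2 * P 2) by ring.
by rewrite EP; ring.
Qed.

Lemma ord3P (j : 'I_3) : [\/ j = 0, j = 1 | j = 2].
Proof.
by case: j => [[|[|[|j]]] ltj] //; [apply: Or31 | apply: Or32 | apply: Or33];
  apply/val_inj.
Qed.

(** At infinity the equation reduces to X^3 = 0. *)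
Lemma on_infinity (a b : k) (P : 'I_3 -> M) :
  on (wcurve (short_weierstrass a b)) i P -> P 2 = 0 ->
  samept P (i \o @worigin k).
Proof.
rewrite on_wcurveP => -[P0 EP] P2.
have P00 : P 0 = 0.
  move/esym/eqP: EP; rewrite P2 !expr0n /= !mulr0 !addr0 expf_eq0 /=.
  by move/eqP.
have P1 : P 1 != 0.
  by case: P0 => j; case: (ord3P j) => ->; rewrite ?P00 ?P2 ?eqxx.
split=> //; exists (P 1)^-1; rewrite ?invr_neq0 // => j /=.
case: (ord3P j) => ->; rewrite /worigin ?P00 ?P2 ?mulr0 ?rmorph0 //.
by rewrite mulVf //= rmorph1.
Qed.

End Points.

(** * Pointed isomorphisms are changes of coordinates *)

(** The conditions under which the families Phi and Psi witness a pointed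
    isomorphism, named because they are symmetric. *)
Definition inverse_pointed_morphisms (k : fieldType) (a b a' b' : k)
    (Phi Psi : ('I_3 -> {mpoly k[3]}) -> Prop) : Prop :=
  let V := wcurve (short_weierstrass a b) in
  let V' := wcurve (short_weierstrass a' b') in
  [/\ is_morphism V V' Phi, is_morphism V' V Psi,
      forall (M : fieldType) (i : {rmorphism k -> M}) P Q, on V i P ->
        maps_to Phi i P Q -> maps_to Psi i Q P,
      forall (M : fieldType) (i : {rmorphism k -> M}) P Q, on V' i Q ->
        maps_to Psi i Q P -> maps_to Phi i P Q
    & maps_to Phi (idfun : {rmorphism k -> k}) (@worigin k) (@worigin k)].

Lemma on_origin (k : fieldType) (a b : k) :
  on (wcurve (short_weierstrass a b)) (idfun : {rmorphism k -> k}) (@worigin k).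
Proof.
rewrite on_wcurveP /worigin /=; split; first by exists 1; rewrite oner_neq0.
by rewrite !expr0n !mulr0 !addr0.
Qed.

Lemma inverse_pointed_morphisms_sym (k : fieldType) (a b a' b' : k) Phi Psi :
  inverse_pointed_morphisms a b a' b' Phi Psi ->
  inverse_pointed_morphisms a' b' a b Psi Phi.
Proof.
case=> mPhi mPsi PhiK PsiK PhiO; split=> // [M i P Q|M i P Q|].
- exact: PsiK.
- exact: PhiK.
exact: (PhiK _ _ _ _ (on_origin _ _) PhiO).
Qed.

Section Isomorphisms.
Variables (k : fieldType) (a b a' b' : k).
Variables (Phi Psi : ('I_3 -> {mpoly k[3]}) -> Prop).
Hypothesis iso : inverse_pointed_morphisms a b a' b' Phi Psi.
Local Notation V := (wcurve (short_weierstrass a b)).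
Local Notation V' := (wcurve (short_weierstrass a' b')).

(** The inverse isomorphism takes the origin to the origin, so a point sent to
    infinity would itself be the origin. *)
Lemma affine_point_maps_to_affine (M : fieldType) (i : {rmorphism k -> M})
    (x y : M) Q :
  affine_pt a b i x y -> maps_to Phi i (pt x y 1) Q -> on V' i Q -> Q 2 != 0.
Proof.
case: iso => _ mPsi PhiK _ _ xyE PQ onQ; apply/eqP => Q2.
case: (inverse_pointed_morphisms_sym iso) => _ _ _ _ [G PsiG [[j Gj] [c c0 OG]]].
case: mPsi => /(_ _ PsiG) [d homG] _ uniq_Psi.
have onP : on V i (pt x y 1) by apply/on_affine.
have QP := PhiK _ _ _ _ onP PQ.
have [_ [e e0 QO]] := on_infinity onQ Q2.
have QOk : maps_to Psi i Q (i \o @worigin k).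
  exists G => //; split.
    exists j; have QO' l : Q l = e^-1 * (i \o @worigin k) l by rewrite QO mulKf.
    rewrite (ev_homog i (homG j) QO') mulf_neq0 ?expf_neq0 ?invr_neq0 //.
    by rewrite ev_base_change fmorph_eq0.
  exists (i c * e ^+ d); first by rewrite mulf_neq0 ?expf_neq0 ?fmorph_eq0.
  move=> l; rewrite -mulrA -(ev_homog i (homG l) QO) ev_base_change /=.
  by rewrite -rmorphM -OG.
have [_ [f f0 /(_ 2)]] := uniq_Psi _ _ _ _ _ onQ QP QOk.
by rewrite /= /worigin /= rmorph0 mulr1 => /esym/eqP; apply/negP.
Qed.

(** The affine coordinates of the image of the generic point are regular at every
    affine point, so they are values of elements of the coordinate ring.  Being
    identities at the generic point, the formulas then hold at every affine
    point. *)
Lemma isomorphism_regval : (2 : k) != 0 ->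
  exists q r, forall (M : fieldType) (i : {rmorphism k -> M}) (x y : M),
    affine_pt a b i x y ->
    maps_to Phi i (pt x y 1) (pt (regval i x y q) (regval i x y r) 1).
Proof.
move=> two0; have [[homPhi defPhi uniqPhi] _ _ _ _] := iso.
have [M0 [i0 [x0 [y0 gen0]]]] := generic_point a b.
have [xy0E reg0] := gen0.
have on0 : on V i0 (pt x0 y0 1) by apply/on_affine.
have [Q0 onQ0 PQ0] := defPhi _ _ _ on0.
have Q02 := affine_point_maps_to_affine xy0E PQ0 onQ0.
(* At any affine point some tuple of forms computes the isomorphism near that
   point; by specialisation the same tuple computes it at the generic point. *)
have loc (M : fieldType) (i : {rmorphism k -> M}) (x y : M) :
    affine_pt a b i x y ->
  exists2 G, Phi G & exists g : 'I_3 -> {poly k} * {poly k},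
      [/\ forall j, ev i (pt x y 1) (G j) = regval i x y (g j),
          regval i x y (g 2) != 0
        & forall j, regval i0 x0 y0 (g 2) * (Q0 j / Q0 2) = regval i0 x0 y0 (g j)].
  move=> xyE; have onP : on V i (pt x y 1) by apply/on_affine.
  have [Q onQ [G PhiG [G0 [c c0 QG]]]] := defPhi _ _ _ onP.
  have Q2 : Q 2 != 0.
    apply: affine_point_maps_to_affine xyE _ onQ.
    by exists G => //; split=> //; exists c.
  have [g Hg] : exists g : 'I_3 -> {poly k} * {poly k},
      forall j (M : fieldType) (i : {rmorphism k -> M}) (x y : M),
      affine_pt a b i x y -> ev i (pt x y 1) (G j) = regval i x y (g j).
    have [g0 H0] := ev_affine_regval a b (G 0).
    have [g1 H1] := ev_affine_regval a b (G 1).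
    have [g2 H2] := ev_affine_regval a b (G 2).
    exists (fun j => nth (0, 0) [:: g0; g1; g2] j) => j.
    by case: (ord3P j) => ->.
  have g2 : regval i x y (g 2) != 0.
    by rewrite -Hg //; move: Q2; rewrite QG mulf_eq0 negb_or => /andP[].
  exists G => //; exists g; split=> // [j|j]; first exact: Hg.
  have g20 : regval i0 x0 y0 (g 2) != 0.
    apply: contraNneq g2 => /reg0 ->.
    by rewrite /regval /= rmorph0 !horner0 mul0r addr0.
  have [] := uniqPhi _ _ _ (fun j => ev i0 (pt x0 y0 1) (G j)) Q0 on0 _ PQ0.
    exists G => //; apply: samept_refl; exists 2; rewrite Hg //.
  move=> _ [d d0 DQ0]; rewrite !DQ0 !Hg //.
  by field; rewrite d0 g20.
have coord l : exists s, Q0 l / Q0 2 = regval i0 x0 y0 s.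
  apply: (regular_everywhere two0 gen0) => M i x y xyE.
  by have [G _ [g [_ g2 Hg]]] := loc M i x y xyE; exists (g l), (g 2).
have [q Dq] := coord 0; have [r Dr] := coord 1.
exists q, r => M i x y xyE.
have [G PhiG [g [Hg g2 Hloc]]] := loc M i x y xyE.
exists G => //; split; first by exists 2; rewrite Hg.
exists (regval i x y (g 2))^-1; rewrite ?invr_neq0 // => j; rewrite Hg.
apply: (mulfI g2); rewrite mulVKf //.
have eqg l s : Q0 l / Q0 2 = regval i0 x0 y0 s ->
    regval i x y (g 2) * regval i x y s = regval i x y (g l).
  move=> Ds; rewrite -(regvalM _ _ xyE); congr (regval i x y _).
  by apply: (regval_inj gen0); rewrite (regvalM _ _ xy0E) -Ds Hloc.
case: (ord3P j) => ->; rewrite /pt /=.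
- exact: eqg Dq.
- exact: eqg Dr.
- by rewrite mulr1.
Qed.

End Isomorphisms.

(** At the generic point (x, y) the isomorphism yields xi and eta in the coordinate
    ring, and its inverse expresses x and y through xi and eta. *)
Lemma change_of_isomorphic (k : fieldType) (a b a' b' : k) :
  3 \in [pchar k] ->
  isomorphic (short_weierstrass a b) (short_weierstrass a' b') ->
  exists u s : k, change_of_coordinates a b a' b' u s.
Proof.
move=> char3 [Phi [Psi iso]]; have two0 := char3_two_neq0 char3.
have {}iso : inverse_pointed_morphisms a b a' b' Phi Psi by [].
have [q [r PhiE]] := isomorphism_regval iso two0.
have [q' [r' PsiE]] := isomorphism_regval (inverse_pointed_morphisms_sym iso) two0.
have [M [i [x [y gen]]]] := generic_point a b; have [xyE _] := gen.
set xi := regval i x y q; set eta := regval i x y r.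
case: iso => [[_ defPhi uniqPhi] [_ _ uniqPsi] PhiK _ _].
have onP : on (wcurve (short_weierstrass a b)) i (pt x y 1) by apply/on_affine.
have PQ := PhiE _ _ _ _ xyE.
have onQ : on (wcurve (short_weierstrass a' b')) i (pt xi eta 1).
  have [Q onQ PQ'] := defPhi _ _ _ onP.
  exact: on_samept (uniqPhi _ _ _ _ _ onP PQ' PQ) onQ.
have QE : affine_pt a' b' i xi eta by apply/on_affine.
have [_ [c c0 Dc]] :=
  uniqPsi _ _ _ _ _ onQ (PsiE _ _ _ _ QE) (PhiK _ _ _ _ onP PQ).
have c1 : c = 1 by have := Dc 2; rewrite /pt /= mulr1.
apply: (coordinate_change (q := q) (r := r) (q' := q') (r' := r') gen char3 QE).
  by have := Dc 0; rewrite c1 mul1r.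
by have := Dc 1; rewrite c1 mul1r.
Qed.

(** * Changes of coordinates are isomorphisms *)

Section ChangeOfCoordinates.
Variables (k : fieldType).

Definition change_forms (u s : k) : 'I_3 -> {mpoly k[3]} :=
  fun j => [:: u ^+ 2 *: 'X_0 + s *: 'X_2; u ^+ 3 *: 'X_1; 'X_2]`_j.

Definition change_pt (M : fieldType) (u s : M) (P : 'I_3 -> M) : 'I_3 -> M :=
  pt (u ^+ 2 * P 0 + s * P 2) (u ^+ 3 * P 1) (P 2).

Lemma ev_change_forms (M : fieldType) (i : {rmorphism k -> M}) u s P j :
  ev i P (change_forms u s j) = change_pt (i u) (i s) P j.
Proof.
rewrite /change_forms /change_pt /pt /ev.
case: (ord3P j) => -> /=.
- rewrite -!mul_mpolyC !(rmorphD, rmorphM) /= !map_mpolyC !map_mpolyX.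
  by rewrite !mevalC !mevalXU.
- by rewrite -mul_mpolyC !rmorphM /= !map_mpolyC !map_mpolyX mevalC mevalXU.
- by rewrite map_mpolyX mevalXU.
Qed.

Lemma change_forms_homog u s j : change_forms u s j \is 1.-homog.
Proof.
have X1 l : ('X_l : {mpoly k[3]}) \is 1.-homog by rewrite dhomogX /= mdeg1.
rewrite /change_forms; case: (ord3P j) => -> /=.
- by rewrite rpredD ?rpredZ.
- by rewrite rpredZ.
- exact: X1.
Qed.

Lemma change_ptK (M : fieldType) (u s : M) (P : 'I_3 -> M) : u != 0 ->
  change_pt u^-1 (- s / u ^+ 2) (change_pt u s P) =1 P.
Proof.
by move=> u0 j; rewrite /change_pt /pt /=; case: (ord3P j) => -> //=; field.
Qed.

Lemma change_pt_neq0 (M : fieldType) (u s : M) (P : 'I_3 -> M) : u != 0 ->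
  (exists j, P j != 0) -> exists j, change_pt u s P j != 0.
Proof.
move=> u0 [j Pj]; apply: NNPP => noj; case/negP: Pj.
have z l : change_pt u s P l = 0.
  by apply/eqP/idPn => nz; apply: noj; exists l.
rewrite -(change_ptK s P u0) {1}/change_pt !z !mulr0 addr0.
by rewrite /pt; case: (ord3P j) => -> /=.
Qed.

Lemma change_ptZ (M : fieldType) (u s c : M) (P Q : 'I_3 -> M) :
  (forall j, Q j = c * P j) -> forall j, change_pt u s Q j = c * change_pt u s P j.
Proof.
by move=> QP j; rewrite /change_pt !QP /pt; case: (ord3P j) => -> /=; ring.
Qed.

(** These are the parameters of the inverse substitution. *)
Lemma change_sym (a b a' b' u s : k) :
  change_of_coordinates a b a' b' u s ->
  change_of_coordinates a' b' a b u^-1 (- s / u ^+ 2).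
Proof.
case=> u0 <- E; split; rewrite ?invr_neq0 //; first by field.
have -> : b' = u ^+ 6 * b - s ^+ 3 - u ^+ 4 * a * s by rewrite E; ring.
by field.
Qed.

Lemma maps_to_change (M : fieldType) (i : {rmorphism k -> M}) u s P Q :
  maps_to (fun G => G = change_forms u s) i P Q <->
  samept (change_pt (i u) (i s) P) Q.
Proof.
split=> [[_ ->]|PQ].
  case=> -[j Pj] [c c0 QP]; split; first by exists j; rewrite -ev_change_forms.
  by exists c => // l; rewrite -ev_change_forms.
exists (change_forms u s) => //; case: PQ => -[j Pj] [c c0 QP].
split; first by exists j; rewrite ev_change_forms.
by exists c => // l; rewrite ev_change_forms.
Qed.

Lemma samept_common (M : fieldType) N (P Q R : 'I_N.+1 -> M) :
  samept P Q -> samept P R -> samept Q R.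
Proof.
move=> PQ; have Q0 := samept_neq0 PQ; case: PQ => _ [c c0 QP] [_ [d d0 RP]].
split=> //; exists (d / c); rewrite ?mulf_neq0 ?invr_neq0 // => j.
by rewrite QP RP mulrA divfK.
Qed.

Lemma on_change_pt (a b a' b' u s : k) : 3 \in [pchar k] ->
  change_of_coordinates a b a' b' u s ->
  forall (M : fieldType) (i : {rmorphism k -> M}) P,
  on (wcurve (short_weierstrass a b)) i P ->
  on (wcurve (short_weierstrass a' b')) i (change_pt (i u) (i s) P).
Proof.
move=> char3 [u0 <- E] M i P; rewrite !on_wcurveP => -[P0 EP].
have three0 : (3 : M) = 0 by rewrite -(rmorph_nat i) pcharf0 ?rmorph0.
split; first by apply: change_pt_neq0; rewrite ?fmorph_eq0.
have -> : b' = u ^+ 6 * b - s ^+ 3 - u ^+ 4 * a * s by rewrite E; ring.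
rewrite /change_pt /pt /=; apply/eqP; rewrite -subr_eq0; apply/eqP.
(* The new equation is u^6 times the old one, up to mixed terms of a cube. *)
transitivity (i u ^+ 6 * (P 1 ^+ 2 * P 2 -
   (P 0 ^+ 3 + i a * P 0 * P 2 ^+ 2 + i b * P 2 ^+ 3)) -
   3 * (i u ^+ 2 * P 0 * i s * P 2 * (i u ^+ 2 * P 0 + i s * P 2))); first by ring.
by rewrite EP subrr mulr0 three0 mul0r subr0.
Qed.

Lemma change_is_morphism (a b a' b' u s : k) : 3 \in [pchar k] ->
  change_of_coordinates a b a' b' u s ->
  is_morphism (wcurve (short_weierstrass a b)) (wcurve (short_weierstrass a' b'))
    (fun G => G = change_forms u s).
Proof.
move=> char3 chg; split=> [_ ->|M i P onP|M i P Q Q' _].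
- by exists 1%N => j; apply: change_forms_homog.
- exists (change_pt (i u) (i s) P); first exact: (on_change_pt char3 chg).
  apply/maps_to_change/samept_refl/change_pt_neq0; last by case: onP.
  by rewrite fmorph_eq0; case: chg.
- by move=> /maps_to_change PQ /maps_to_change; apply: samept_common.
Qed.

Lemma change_inverse (u s : k) (M : fieldType) (i : {rmorphism k -> M}) P Q :
  u != 0 -> (exists j, P j != 0) ->
  maps_to (fun G => G = change_forms u s) i P Q ->
  maps_to (fun G => G = change_forms u^-1 (- s / u ^+ 2)) i Q P.
Proof.
move=> u0 P0 /maps_to_change PQ; apply/maps_to_change.
have iu0 : i u != 0 by rewrite fmorph_eq0.
have Q0 := samept_neq0 PQ; case: PQ => _ [c c0 QP].
split; first by apply: change_pt_neq0; rewrite ?fmorph_eq0 ?invr_neq0.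
exists c^-1; rewrite ?invr_neq0 // => j.
rewrite fmorphV !rmorphM rmorphN fmorphV rmorphXn (change_ptZ _ _ QP) /=.
by rewrite change_ptK // mulKf.
Qed.

Lemma isomorphic_of_change (a b a' b' u s : k) : 3 \in [pchar k] ->
  change_of_coordinates a b a' b' u s ->
  isomorphic (short_weierstrass a b) (short_weierstrass a' b').
Proof.
move=> char3 chg; have u0 : u != 0 by case: chg.
exists (fun G => G = change_forms u s).
exists (fun G => G = change_forms u^-1 (- s / u ^+ 2)); split.
- exact: change_is_morphism.
- exact/change_is_morphism/change_sym.
- by move=> M i P Q [P0 _]; apply: change_inverse.
- move=> M i P Q [Q0 _] /change_inverse; rewrite invr_neq0 // => /(_ isT Q0).
  rewrite invrK; suff -> : - (- s / u ^+ 2) / u^-1 ^+ 2 = s by [].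
  by field; rewrite u0 oner_neq0.
- apply/maps_to_change; split.
    by apply: change_pt_neq0 => //; exists 1; rewrite /worigin oner_neq0.
  exists (u ^- 3); rewrite ?invr_neq0 ?expf_neq0 // => j.
  by rewrite /change_pt /pt /worigin; case: (ord3P j) => -> /=; field.
Qed.

Lemma mderivXU n (i j : 'I_n) : ('X_i : {mpoly k[n]})^`M(j) = (i == j)%:R.
Proof.
rewrite mderivX mnm1E; case: eqP => [->|_]; last by rewrite scale0r.
rewrite scale1r; suff -> : (U_(j) - U_(j))%MM = 0%MM by rewrite mpolyX0.
by apply/mnmP => l; rewrite mnmBE mnm0E subnn.
Qed.

(** The coefficients divisible by 3 are kept, so that the formula holds in every
    characteristic. *)
Lemma ev_gradient (M : fieldType) (i : {rmorphism k -> M}) (a b : k) P j :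
  ev i P (wform (short_weierstrass a b))^`M(j) =
  pt (- (3 * P 0 ^+ 2 + i a * P 2 ^+ 2)) (2 * P 1 * P 2)
     (P 1 ^+ 2 - (2 * (i a * P 0 * P 2) + 3 * (i b * P 2 ^+ 2))) j.
Proof.
rewrite /ev /wform /= !scale0r !addr0 !exprS !expr0 !mulr1.
rewrite !(mderivD, mderivN, mderivZ, mderivM, mderivXU) -!mul_mpolyC.
by case: (ord3P j) => -> /=;
  rewrite !(rmorphB, rmorphD, rmorphM, rmorph0, rmorph1) /= !map_mpolyC !map_mpolyX
   !mevalC !mevalXU /pt /=; ring.
Qed.

(** In characteristic 3 the X-derivative is -a Z^2, which vanishes only at infinity,
    and there the Z-derivative Y^2 does not vanish. *)
Lemma elliptic_short (a b : k) : 3 \in [pchar k] -> a != 0 ->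
  elliptic (short_weierstrass a b).
Proof.
move=> char3 a0 M i P onP; exists 1%N, (fun _ => wform (short_weierstrass a b)).
split=> [_ L l Q [_]|]; first exact.
have two0 : (2 : M) != 0 by rewrite -(rmorph_nat i) fmorph_eq0 char3_two_neq0.
have three0 : (3 : M) = 0 by rewrite -(rmorph_nat i) pcharf0 ?rmorph0.
rewrite rank_rV; case: eqP => // /rowP D0.
have {D0} grad0 j : ev i P (wform (short_weierstrass a b))^`M(j) = 0.
  by have := D0 j; rewrite !mxE.
have P2 : P 2 = 0.
  have /eqP := grad0 0; rewrite ev_gradient /pt /= three0 mul0r add0r oppr_eq0.
  by rewrite mulf_eq0 fmorph_eq0 (negPf a0) expf_eq0 /= => /eqP.
have P1 : P 1 = 0.
  have /eqP := grad0 2; rewrite ev_gradient /pt /= P2 !expr0n /= !mulr0 addr0 subr0.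
  by rewrite expf_eq0 /= => /eqP.
have [_ [c _ /(_ 1)]] := on_infinity onP P2.
by rewrite /worigin /= P1 mulr0 rmorph1 => /eqP; rewrite oner_eq0.
Qed.

End ChangeOfCoordinates.

(** * Twists of y^2 = x^3 - x *)

Lemma wmap_short (k M : fieldType) (i : {rmorphism k -> M}) (a b : k) :
  wmap i (short_weierstrass a b) = short_weierstrass (i a) (i b).
Proof. by rewrite /wmap /short_weierstrass /= rmorph0. Qed.

Section Twists.
Variables (K : fieldType).
Hypothesis char3 : 3 \in [pchar K].

Lemma isomorphic_overP (L : fieldExtType K) (a b a' b' : K) :
  isomorphic_over L (short_weierstrass a b) (short_weierstrass a' b') <->
  exists u s : L, change_of_coordinates a%:A b%:A a'%:A b'%:A u s.
Proof.
have charL : 3 \in [pchar L] by rewrite pchar_lalg.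
rewrite /isomorphic_over !wmap_short; split; first exact: change_of_isomorphic.
by case=> u [s chg]; apply: isomorphic_of_change chg.
Qed.

(** An extension generated by a root of p has degree at most m, and the curves become
    isomorphic over it; the lower bound then makes the degree equal to m. *)
Lemma is_twist_of_poly (a b a' b' : K) (p : {poly K}) (m : nat) :
  a != 0 -> a' != 0 -> (0 < m)%N -> size p = m.+1 ->
  (forall (L : fieldExtType K) (z : L), root (map_poly (in_alg L) p) z ->
     exists u s : L, change_of_coordinates a%:A b%:A a'%:A b'%:A u s) ->
  (forall (L : fieldExtType K) (u s : L),
     change_of_coordinates a%:A b%:A a'%:A b'%:A u s -> (m <= \dim {:L})%N) ->
  is_twist m (short_weierstrass a b) (short_weierstrass a' b').
Proof.
move=> a0 a'0 m_gt0 szp root_chg dim_chg; split.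
- exact: elliptic_short.
- exact: elliptic_short.
- have [|L [z [dimL pz]]] := @extension_with_root K p; first by rewrite szp.
  have [u [s chg]] := root_chg L z pz.
  exists L; split; last by apply/isomorphic_overP; exists u, s.
  by apply/eqP; rewrite eqn_leq (dim_chg L u s chg) andbT; rewrite szp in dimL.
- move=> L ltLm /isomorphic_overP [u [s /dim_chg]].
  by rewrite leqNgt ltLm.
Qed.

Variables (e f : K).
Hypothesis sqr_e : e ^+ 2 = -1.
Hypothesis nsq_f : forall h, f <> h ^+ 2.
Local Notation E := (short_weierstrass (-1 : K) 0).

(** Here u^2 = f or u^2 = -f, and in the second case e u is a square root of f. *)
Lemma even_dim_sqrt_sqr (L : fieldExtType K) (u : L) :
  u ^+ 4 = (f ^+ 2)%:A -> (2 %| \dim {:L})%N.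
Proof.
rewrite -in_algE rmorphXn /= -[4%N]/(2 * 2)%N exprM => /eqP.
rewrite eqf_sqr => /orP[] /eqP Du; first exact: even_dim_sqrt nsq_f Du.
apply: (@even_dim_sqrt _ _ _ (e%:A * u) nsq_f).
by rewrite exprMn Du -in_algE -rmorphXn sqr_e rmorphN1 mulN1r opprK.
Qed.

Lemma change_from_E (L : fieldExtType K) (a' b' : K) (u s : L) :
  change_of_coordinates (-1)%:A 0%:A a'%:A b'%:A u s <->
  [/\ u != 0, u ^+ 4 = (- a')%:A & s ^+ 3 + a'%:A * s + b'%:A = 0].
Proof.
rewrite /change_of_coordinates scale0r mulr0 !scaleNr scale1r mulrN1.
split=> -[u0 Du Ds]; split=> //.
  by rewrite -Du opprK.
by rewrite Du opprK.
Qed.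

Lemma quadratic_twist : is_twist 2 E (short_weierstrass (- f ^+ 2) 0).
Proof.
apply: (@is_twist_of_poly _ _ _ _ ('X^2 - f%:P)) => //.
- by rewrite oppr_eq0 oner_neq0.
- by rewrite oppr_eq0 expf_neq0 ?(nonsquare_neq0 nsq_f).
- by rewrite size_XnsubC.
- move=> L z; rewrite rmorphB rmorphXn /= map_polyX map_polyC /root !hornerE /=.
  rewrite subr_eq0 => /eqP Dz; exists z, 0; apply/change_from_E; split.
  + exact: root_neq0 (nonsquare_neq0 nsq_f) Dz.
  + by rewrite opprK -in_algE rmorphXn /= -Dz -exprM.
  + by rewrite expr0n scale0r mulr0 !addr0.
- move=> L u s /change_from_E [_ Du _]; apply: dvdn_leq (adim_gt0 _) _.
  by apply: (even_dim_sqrt_sqr (u := u)); rewrite Du opprK.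
Qed.

Lemma cubic_twist (g : K) : (forall h, g <> h ^+ 3 - h) ->
  is_twist 3 E (short_weierstrass (-1) (- g)).
Proof.
move=> g_as; apply: (@is_twist_of_poly _ _ _ _ ('X^3 - ('X + g%:P))) => //.
- by rewrite oppr_eq0 oner_neq0.
- by rewrite oppr_eq0 oner_neq0.
- by rewrite size_polyDl ?size_polyXn // size_polyN size_XaddC.
- move=> L z; rewrite rmorphB rmorphD rmorphXn /= map_polyX map_polyC /root !hornerE /=.
  move=> /eqP Dz; exists 1, z; apply/change_from_E; split.
  + exact: oner_neq0.
  + by rewrite opprK expr1n scale1r.
  + by rewrite -Dz !scaleNr scale1r; ring.
- move=> L u s /change_from_E [_ _ Ds]; apply: dvdn_leq (adim_gt0 _) _.
  apply: (dvd3_dim_artin_schreier (t := s) g_as); apply/eqP.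
  by rewrite -subr_eq0 -[X in _ == X]Ds !scaleNr scale1r mulN1r.
Qed.

Lemma quartic_twist (c : K) : (forall h, c <> h ^+ 2) ->
  is_twist 4 E (short_weierstrass (- c) 0).
Proof.
move=> nsq_c; have c0 := nonsquare_neq0 nsq_c.
apply: (@is_twist_of_poly _ _ _ _ ('X^4 - c%:P)) => //.
- by rewrite oppr_eq0 oner_neq0.
- by rewrite oppr_eq0.
- by rewrite size_XnsubC.
- move=> L z; rewrite rmorphB rmorphXn /= map_polyX map_polyC /root !hornerE /=.
  rewrite subr_eq0 => /eqP Dz; exists z, 0; apply/change_from_E; split.
  + exact: root_neq0 c0 Dz.
  + by rewrite opprK.
  + by rewrite expr0n scale0r mulr0 !addr0.
- move=> L u s /change_from_E [_ Du _]; rewrite opprK in Du.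
  exact: dim_quartic_root sqr_e nsq_c Du.
Qed.

(** An isomorphism over L amounts to u^4 = f^2 and s^3 - f^2 s + f^3 g = 0.  The
    first gives a square root of f, and t = - s / f satisfies t^3 - t = g, so 2 and
    3 both divide the degree.  Conversely if v^2 = f and t^3 - t = g, then w = t v
    satisfies w^3 - f w = f g v, so w is a root of the polynomial of degree 6
    obtained by squaring; from w one recovers v and t = w / v. *)
Lemma sextic_twist (g : K) : (forall h, g <> h ^+ 3 - h) ->
  is_twist 6 E (short_weierstrass (- f ^+ 2) (f ^+ 3 * g)).
Proof.
move=> g_as; have f0 := nonsquare_neq0 nsq_f.
have g0 : g != 0 by apply/eqP => g0; apply: (g_as 0); rewrite g0 expr0n subr0.
pose p : {poly K} := ('X^3 - f *: 'X) ^+ 2 - (f ^+ 3 * g ^+ 2)%:P.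
have szp : size p = 7%N.
  have sz3 : size ('X^3 - f *: 'X : {poly K}) = 4%N.
    rewrite size_polyDl ?size_polyXn // size_polyN.
    by rewrite (leq_ltn_trans (size_scale_leq _ _)) ?size_polyX.
  rewrite /p size_polyDl ?size_sqr ?sz3 // size_polyN.
  by rewrite (leq_ltn_trans (size_polyC_leq1 _)).
apply: (@is_twist_of_poly _ _ _ _ p) => //.
- by rewrite oppr_eq0 oner_neq0.
- by rewrite oppr_eq0 expf_neq0.
- move=> L w; have [A AE] : exists A : {rmorphism K -> L}, in_alg L =1 A.
    by exists (in_alg L).
  have A0 c : (A c == 0) = (c == 0) by rewrite fmorph_eq0.
  rewrite (eq_map_poly AE) /p -mul_polyC !(rmorphB, rmorphXn, rmorphM) /=.
  rewrite map_polyX !map_polyC /root !hornerE /= subr_eq0 => /eqP Dw.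
  (* v is the square root of f, recovered from w^3 - f w = f g v. *)
  pose v := (w ^+ 3 - A f * w) / (A f * A g).
  have Dv : v ^+ 2 = A f.
    have -> : v ^+ 2 = (w ^+ 3 - A f * w) ^+ 2 / (A f * A g) ^+ 2.
      by rewrite expr_div_n.
    rewrite !exprS !expr0 !mulr1 in Dw *; rewrite Dw.
    by field; rewrite !A0 f0 g0.
  have v0 : v != 0 by apply: (root_neq0 (n := 1) f0); rewrite Dv -AE.
  have Dw3 : w ^+ 3 - A f * w = A f * A g * v.
    by rewrite /v; field; rewrite !A0 f0 g0.
  exists v, (- A f * (w / v)); apply/change_from_E.
  rewrite -!/(in_alg L _) !AE; split=> //.
  + by rewrite opprK rmorphXn -Dv -exprM.
  + have Dw3' : w ^+ 3 = A f * A g * v + A f * w by rewrite -Dw3; ring.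
    have -> : (- A f * (w / v)) ^+ 3 = - A f ^+ 3 * w ^+ 3 / (v ^+ 2 * v) by field.
    rewrite Dw3' Dv rmorphM !rmorphN !rmorphXn /=.
    by field; rewrite v0 A0 f0.
- move=> L u s /change_from_E [_ Du Ds].
  have d2 : (2 %| \dim {:L})%N.
    by apply: (@even_dim_sqrt_sqr L u); rewrite Du opprK.
  have d3 : (3 %| \dim {:L})%N.
    have [A AE] : exists A : {rmorphism K -> L}, forall c, c%:A = A c.
      by exists (in_alg L).
    apply: (dvd3_dim_artin_schreier (t := - s / A f) g_as).
    move: Ds; rewrite !AE => Ds.
    have fA : A f != 0 by rewrite fmorph_eq0.
    have fA3 : - A f ^+ 3 != 0 by rewrite oppr_eq0 expf_neq0.
    apply: (mulfI fA3); apply/eqP; rewrite -subr_eq0 -[X in _ == X]Ds.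
    rewrite rmorphM rmorphN !rmorphXn /=.
    by apply/eqP; field.
  apply: dvdn_leq (adim_gt0 _) _.
  by rewrite (Gauss_dvd _ (isT : coprime 2 3)) d2.
Qed.

End Twists.

(** X^5 - X has at most five roots, so some nonzero x satisfies x^4 <> 1; since
    x^8 = 1, x^4 = -1. *)
Lemma sqrtN1_F9 (F9 : finFieldType) : #|F9| = 9%N -> exists e : F9, e ^+ 2 = -1.
Proof.
move=> hF9.
have [x x0 x4] : exists2 x : F9, x != 0 & x ^+ 4 != 1.
  apply: NNPP => nox; have /max_poly_roots : ('X^5 - 'X : {poly F9}) != 0.
    by rewrite -size_poly_eq0 size_polyDl ?size_polyXn // size_polyN size_polyX.
  move/(_ (enum F9) _ (enum_uniq _)); rewrite -cardE hF9.
  rewrite size_polyDl ?size_polyXn ?size_polyN ?size_polyX // => H.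
  suff /H : all (root ('X^5 - 'X)) (enum F9) by [].
  apply/allP => x _; rewrite /root !hornerE subr_eq0.
  have [->|x0] := eqVneq x 0; first by rewrite expr0n.
  rewrite exprS; apply: contraT => x5; case: nox; exists x => //.
  by apply: contra x5 => /eqP ->; rewrite mulr1.
exists (x ^+ 2); rewrite -exprM; apply/eqP.
have /eqP : x ^+ 8 = 1.
  by apply: (mulfI x0); rewrite -exprS mulr1 -{2}(expf_card x) hF9.
by rewrite -[8%N]/(4 * 2)%N exprM sqrf_eq1 (negPf x4).
Qed.

Theorem theoremA (n : nat) (hn : (1 <= n)%N)
    (F9 : finFieldType) (hF9 : #|F9| = 9%N)
    (Fq : finFieldType) (hFq : #|Fq| = (3 ^ (2 * n))%N)
    (j : {rmorphism F9 -> Fq})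
    (N : nat) (X : projset Fq N) (hX : is_curve X)
    (K : fieldType) (iota : {rmorphism Fq -> K}) (hK : function_field X iota)
    (f g : K)
    (hf : forall c : Fq, f <> iota c) (hg : forall c : Fq, g <> iota c)
    (hfsq : forall h : K, f <> h ^+ 2)
    (hgas : forall h : K, g <> h ^+ 3 - h) :
  let E : weierstrass F9 := short_weierstrass (- 1) 0 in
  let EK : weierstrass K := wmap (iota \o j) E in
  is_twist 2 EK (short_weierstrass (- f ^+ 2) 0) /\
  is_twist 3 EK (short_weierstrass (- 1) (- g)) /\
  is_twist 3 EK (short_weierstrass (- 1) g) /\
  is_twist 4 EK (short_weierstrass (- f) 0) /\
  is_twist 4 EK (short_weierstrass (- f ^+ 3) 0) /\
  is_twist 6 EK (short_weierstrass (- f ^+ 2) (f ^+ 3 * g)) /\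
  is_twist 6 EK (short_weierstrass (- f ^+ 2) (- (f ^+ 3 * g))).
Proof.
have char3 : 3 \in [pchar K].
  by apply: (rmorph_pchar iota); apply: card_finPcharP hFq _.
have [e0 De0] := sqrtN1_F9 hF9; pose e := iota (j e0).
have De : e ^+ 2 = -1 by rewrite /e -!rmorphXn De0 !rmorphN1.
have hgas' h : - g <> h ^+ 3 - h.
  by move=> Dg; apply: (hgas (- h)); rewrite -[g]opprK Dg; ring.
have f0 := nonsquare_neq0 hfsq.
have hf3sq h : f ^+ 3 <> h ^+ 2.
  by move=> Dh; apply: (hfsq (h / f)); rewrite expr_div_n -Dh; field.
move=> E EK; have -> : EK = short_weierstrass (-1) 0.
  by rewrite /EK /E wmap_short rmorphN1 rmorph0.
split; first exact: quadratic_twist De hfsq.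
split; first exact: cubic_twist.
split; first by rewrite -[g]opprK; apply: cubic_twist.
split; first exact: quartic_twist De _ hfsq.
split; first exact: quartic_twist De _ hf3sq.
split; first exact: sextic_twist De hfsq _ hgas.
by rewrite -[- (f ^+ 3 * g)]mulrN; apply: sextic_twist De hfsq _ hgas'.
Qed.
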